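(* Over the ground ring $\mathbb{Z}$, the morphism of dg operads $p:\mathsf{Quilt}\longrightarrow \mathsf{Brace}$, defined on basis elements $(W,T)\in \mathsf{Quilt}(n)$ by $p(W,T)=T$ if $|W|=n$ and $p(W,T)=0$ otherwise, is a quasi-isomorphism (where $\mathsf{Brace}$ is concentrated in degree $0$ with zero differential).
   Context: Conventions: gradings are cohomological, differentials have degree $+1$. $\langle n\rangle=\{1,\dots,n\}$, $k$ is the ground ring. Trees and $\mathsf{Brace}$. $\mathrm{Tree}(n)$ ($n\ge 1$) is the set of planar rooted trees with vertex set $\langle n\rangle$. For $T\in\mathrm{Tree}(n)$, $u<_T v$ means $u\ne v$ lies on the path from the root to $v$; $u\lhd_T v$ means that $u,v$ are incomparable for $<_T$ and $u$ lies to the left of $v$. $\mathsf{Brace}(n)$ is the free $k$-module on $\mathrm{Tree}(n)$, with symmetric group action by relabelling, and $T\circ_i T'=\sum_{U\in \mathrm{Ext}(T,T',i)}U$, where for $T\in \mathrm{Tree}(m)$, $T'\in\mathrm{Tree}(n)$, $\mathrm{Ext}(T,T',i)\subseteq \mathrm{Tree}(m+n-1)$ is the set of trees $U$ containing $T'$ (relabelled by $a\mapsto a+i-1$) as a subtree whose contraction to the single vertex $i$ gives $T$ (labels $>i$ of $T$ being shifted by $n-1$); i.e. $T'$ replaces vertex $i$ and the children of $i$ are reattached to vertices of $T'$ in all ways compatible with the planar order. Words and $F_2\mathsf{Surj}$. $\mathrm{FWord}(n)$ is the set of words $W$ in the letters $\langle n\rangle$ such that every letter occurs, $W\neq\ldots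 uu\ldots$, and for $u\ne v$, $W\ne \ldots u\ldots v\ldots u\ldots v\ldots$. $|W|$ is the length. Put $u<_W v$ if $W=\ldots u\ldots v\ldots u\ldots$, and $u\lhd_W v$ if all occurrences of $u$ are left of all occurrences of $v$. $F_2\mathsf{Surj}(n)$ is the free $k$-module on $\mathrm{FWord}(n)$, graded by $\deg(W)=n-|W|$, with symmetric groups permuting letters ($W^\sigma=\sigma^{-1}W$). An occurrence of a letter is a caesura if the same letter occurs again later. Differential: $\partial W=\sum_i \mathrm{sgn}_W(i)\,\partial_iW$, where $\partial_i W$ is obtained by deleting the $i$-th letter if that letter occurs more than once in $W$, and is $0$ otherwise; $\mathrm{sgn}_W(i)=(-1)^j$ if the $i$-th letter is the $j$-th caesura, and $\mathrm{sgn}_W(i)=(-1)^{j+1}$ if it is the last occurrence of a repeated letter whose previous occurrence is the $j$-th caesura. Composition: for $W\in\mathrm{FWord}(m)$, $W'\in\mathrm{FWord}(n)$ let $\alpha(a)=a+i-1$ on $\langle n\rangle$ and let $\beta:\langle m+n-1\rangle\to\langle m\rangle$ be the order preserving map collapsing $\{i,\dots,i+n-1\}$ to $i$. $\mathrm{Ext}(W,W',i)$ is the set of $X\in \mathrm{FWord}(m+n-1)$ such that the subword of $X$ on the letters $\alpha(\langle n\rangle)$, after deleting adjacent repetitions, is $\alpha(W')$, and $\beta(X)$, after deleting adjacent repetitions, is $W$. Then $W\circ_iW'=\sum_X \mathrm{sgn}(X)X$. Sign: a letter $a$ is interposed in $W$ if $W=\ldots ba\ldots b\ldots$ for some $b$;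 $\mathrm{int}(W)$ is the set of interposed letters ordered by first occurrence. With $\gamma(a)=\beta^{-1}(a)$ for $a\neq i$ and $\gamma(i)=\alpha(\text{first letter of }W')$, the set $\mathrm{int}(X)$ is the disjoint union of $\gamma(\mathrm{int}(W))$ and $\alpha(\mathrm{int}(W'))$, and $\mathrm{sgn}(X)$ is the sign of the corresponding shuffle. $\mathsf{Quilt}$. $\mathsf{Quilt}\subseteq F_2\mathsf{Surj}\otimes_H\mathsf{Brace}$ (Hadamard, i.e. aritywise, tensor product) is the dg suboperad with $\mathsf{Quilt}(n)$ spanned by the pairs $(W,T)\in\mathrm{FWord}(n)\times\mathrm{Tree}(n)$ such that (i) $u<_Tv$ implies $u\lhd_W v$, and (ii) $u<_Wv$ implies $v\lhd_T u$. Such pairs are called quilts. The degree of $(W,T)$ is $n-|W|$ and $\partial(W,T)=(\partial W,T)$.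
   Formalization: In the composition of F_2Surj, Ext(W,W',i) is restricted to words X with |X| = |W|+|W'|-1; without this, 132 would lie in Ext(121,12,1), with the wrong degree and no defined sign. *)

(* Defs.v *)
From HB Require Import structures.
From mathcomp Require Import all_boot all_fingroup all_algebra.
From mathcomp Require Import finmap monalg.
From mathcomp Require Import zify.

Set Implicit Arguments.
Unset Strict Implicit.
Unset Printing Implicit Defensive.

Import GRing.Theory.
Local Open Scope ring_scope.

(* Conventions: <n> is 'I_n, so labels and letters are numbered from 0, and   *)
(* the component of arity n + 1 of an operad is indexed by n, so that         *)
(* o_i : P(m+1) x P(n+1) -> P(m+n+1).  Arity 0 is left out: there is no       *)
(* planar rooted tree without vertices, so Brace(0) = Quilt(0) = 0.           *)

(* Only the operations of a dg operad are recorded, not its axioms: a        *)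
(* morphism is a family of maps compatible with them.  op_homog k is the      *)
(* component of degree k; the differential has degree + 1.                    *)
Record dg_operad_data := DgOperadData {
  op_mod :> nat -> zmodType;
  op_homog : forall n, int -> pred (op_mod n);
  op_d : forall n, op_mod n -> op_mod n;
  op_act : forall n, op_mod n -> 'S_n.+1 -> op_mod n;
  op_one : op_mod 0%N;
  op_comp : forall m n, 'I_m.+1 -> op_mod m -> op_mod n -> op_mod (m + n)%N
}.
Arguments op_homog _ {n}.
Arguments op_d _ {n}.
Arguments op_act _ {n}.
Arguments op_comp _ {m n}.

Record dg_operad_morphism (P Q : dg_operad_data) (f : forall n, P n -> Q n) :
    Prop := DgOperadMorphism {
  dgm_additive : forall n (x y : P n), f n (x + y) = f n x + f n y;
  dgm_homog : forall n k (x : P n), op_homog P k x -> op_homog Q k (f n x);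
  dgm_d : forall n (x : P n), f n (op_d P x) = op_d Q (f n x);
  dgm_act : forall n (x : P n) (s : 'S_n.+1),
    f n (op_act P x s) = op_act Q (f n x) s;
  dgm_one : f 0%N (op_one P) = op_one Q;
  dgm_comp : forall m n (i : 'I_m.+1) (x : P m) (y : P n),
    f (m + n)%N (op_comp P i x y) = op_comp Q i (f m x) (f n y)
}.

Arguments dg_operad_morphism P Q f : clear implicits.

Definition cocycle (P : dg_operad_data) n (k : int) (x : P n) : Prop :=
  op_homog P k x /\ op_d P x = 0.

Definition coboundary (P : dg_operad_data) n (k : int) (x : P n) : Prop :=
  exists2 y : P n, op_homog P (k - 1) y & x = op_d P y.

(* H^k(f n) is injective and surjective, in every arity and every degree k.   *)
Definition quasi_isomorphism (P Q : dg_operad_data)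
    (f : forall n, P n -> Q n) : Prop :=
  forall n (k : int),
    (forall x : P n, cocycle k x -> coboundary k (f n x) -> coboundary k x) /\
    (forall y : Q n, cocycle k y ->
       exists2 x : P n, cocycle k x & coboundary k (y - f n x)).
Arguments quasi_isomorphism P Q f : clear implicits.

Section Free.
Variables B C : choiceType.

Definition linext (f : B -> {malg int[C]}) (x : {malg int[B]}) :
    {malg int[C]} :=
  \sum_(b <- msupp x) x@_b *: f b.

Definition tens (x : {malg int[B]}) (y : {malg int[C]}) :
    {malg int[(B * C)%type]} :=
  \sum_(b <- msupp x) \sum_(c <- msupp y) << x@_b * y@_c *g (b, c) >>.

Definition supported (P : pred B) : {pred {malg int[B]}} :=
  fun x => all P (msupp x).

Lemma supportedP (P : pred B) (x : {malg int[B]}) :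
  reflect (forall b, x@_b != 0 -> P b) (x \in supported P).
Proof.
apply: (iffP allP) => h b; first by rewrite mcoeff_neq0 => /h.
by rewrite -mcoeff_neq0 => /h.
Qed.

Fact supported_zmod_closed P : zmod_closed (supported P).
Proof.
split=> [|x y /supportedP hx /supportedP hy].
  by apply/supportedP => b; rewrite mcoeff0 eqxx.
apply/supportedP => b; rewrite mcoeffB.
have [->|/hx //] := eqVneq x@_b 0; have [->|/hy //] := eqVneq y@_b 0.
by rewrite subr0 eqxx.
Qed.
HB.instance Definition _ P :=
  GRing.isZmodClosed.Build {malg int[B]} (supported P) (supported_zmod_closed P).

Lemma supportedZ P c (x : {malg int[B]}) :
  x \in supported P -> c *: x \in supported P.
Proof.
move=> /supportedP h; apply/supportedP => b; rewrite mcoeffZ => nz.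
by apply: h; apply: contraNneq nz => ->; rewrite mulr0.
Qed.

Lemma supportedU (P : pred B) c b :
  (c != 0 -> P b) -> << c *g b >> \in supported P.
Proof.
move=> h; apply/supportedP => b'; rewrite mcoeffU.
by have [<-|//] := eqVneq b b'; rewrite mulr1n => /h.
Qed.

End Free.

Lemma supported_linext (B C : choiceType) (P : pred B) (Q : pred C)
    (f : B -> {malg int[C]}) x :
  x \in supported P -> (forall b, P b -> f b \in supported Q) ->
  linext f x \in supported Q.
Proof.
move=> /allP hx hf; rewrite /linext big_seq; apply: rpred_sum => b bx.
by apply: supportedZ; apply: hf; apply: hx.
Qed.

Lemma supported_tens (B C : choiceType) (P : pred B) (Q : pred C)
    (R : pred (B * C)) x y :
  x \in supported P -> y \in supported Q ->
  (forall b c, P b -> Q c -> R (b, c)) -> tens x y \in supported R.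
Proof.
move=> /allP hx /allP hy h; rewrite /tens big_seq; apply: rpred_sum => b bx.
rewrite big_seq; apply: rpred_sum => c cy.
by apply: supportedU => _; apply: h; [apply: hx|apply: hy].
Qed.

Section Labels.
Variables (m n : nat) (i : 'I_m.+1).

Definition alpha (a : 'I_n.+1) : 'I_(m + n).+1 := inord (i + a).

Definition beta (c : 'I_(m + n).+1) : 'I_m.+1 :=
  inord (if (c < i)%N then c : nat else if (c <= i + n)%N then i : nat
         else (c - n)%N).

Definition block : pred 'I_(m + n).+1 := fun c => (i <= c <= i + n)%N.

Lemma alphaE a : alpha a = (i + a)%N :> nat.
Proof.
by rewrite inordK // ltnS leq_add // -ltnS ltn_ord.
Qed.

Lemma alpha_inj : injective alpha.
Proof.
by move=> a b /(congr1 val); rewrite /= !alphaE => /addnI /val_inj.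
Qed.

Lemma blockP c : reflect (exists a, c = alpha a) (block c).
Proof.
apply: (iffP andP) => [[h1 h2]|[a ->]].
  exists (inord (c - i)); apply: val_inj.
  by rewrite /= alphaE inordK ?subnKC // ltnS leq_subLR.
by rewrite alphaE leq_addr leq_add2l -ltnS ltn_ord.
Qed.

Lemma betaE c : beta c = (if (c < i)%N then c : nat
  else if (c <= i + n)%N then i : nat else (c - n)%N) :> nat.
Proof.
rewrite inordK //; case: (ltnP c i) => [h|_]; first exact: ltn_trans h (ltn_ord i).
case: (leqP c (i + n)) => _; first exact: ltn_ord.
by have := ltn_ord c; rewrite !ltnS leq_subLR (addnC n).
Qed.

Lemma beta_inj c c' : beta c = beta c' -> c != c' -> block c && block c'.
Proof.
move=> /(congr1 val); rewrite /= !betaE -val_eqE /= /block => h /eqP ne.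
have := leq_ord i; move: h ne.
case: (ltnP c i) => ?; case: (ltnP c' i) => ?;
  case: (leqP c (i + n)) => ?; case: (leqP c' (i + n)) => ?; lia.
Qed.

End Labels.

Inductive ptree (A : Type) := PNode of A & seq (ptree A).

Section PTree.
Variable A : Type.

Definition root (t : ptree A) := let: PNode a _ := t in a.
Definition children (t : ptree A) := let: PNode _ ts := t in ts.

(* in planar preorder *)
Fixpoint labels (t : ptree A) : seq A :=
  let: PNode a ts := t in a :: flatten (map labels ts).

Fixpoint subtrees (t : ptree A) : seq (ptree A) :=
  let: PNode a ts := t in t :: flatten (map subtrees ts).

Definition flabels (ts : seq (ptree A)) : seq A := flatten (map labels ts).

Fixpoint ptree_encode (t : ptree A) : GenTree.tree A :=
  let: PNode a ts := t in
  GenTree.Node 0 (GenTree.Leaf a :: map ptree_encode ts).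

Fixpoint ptree_decode (t : GenTree.tree A) : option (ptree A) :=
  if t is GenTree.Node _ (GenTree.Leaf a :: ts)
  then Some (PNode a (pmap ptree_decode ts)) else None.

Lemma ptree_ind_all (P : ptree A -> Prop) :
  (forall a ts, foldr (fun t => and (P t)) True ts -> P (PNode a ts)) ->
  forall t, P t.
Proof.
move=> h; fix IH 1 => -[a ts]; apply: h.
by elim: ts => //= t ts IHts; split.
Qed.

Lemma ptree_encodeK : pcancel ptree_encode ptree_decode.
Proof.
elim/ptree_ind_all => a ts IH /=; congr (Some (PNode a _)).
by elim: ts IH => //= t ts IHts [-> /IHts ->].
Qed.

End PTree.

HB.instance Definition _ (A : eqType) := Equality.copy (ptree A)
  (pcan_type (@ptree_encodeK A)).
HB.instance Definition _ (A : choiceType) := Choice.copy (ptree A)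
  (pcan_type (@ptree_encodeK A)).
HB.instance Definition _ (A : countType) := Countable.copy (ptree A)
  (pcan_type (@ptree_encodeK A)).

Lemma ptree_ind_mem (A : eqType) (P : ptree A -> Prop) :
  (forall a ts, (forall t, t \in ts -> P t) -> P (PNode a ts)) ->
  forall t, P t.
Proof.
move=> h; elim/ptree_ind_all => a ts IH; apply: h => t.
by elim: ts IH => //= t' ts IHts [ht /IHts hts]; rewrite inE => /predU1P [->|].
Qed.

Fixpoint tmap (A B : Type) (f : A -> B) (t : ptree A) : ptree B :=
  let: PNode a ts := t in PNode (f a) (map (tmap f) ts).

Section TreeRelations.
Variable A : eqType.
Implicit Types (t s : ptree A) (ts : seq (ptree A)) (u v : A).

(* u <_T v, for T with pairwise distinct labels *)
Definition tree_lt t u v : bool :=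
  (u != v) && has (fun s => (root s == u) && (v \in labels s)) (subtrees t).

Definition forest_left ts u v : bool :=
  has (fun k => (u \in flabels (take k ts)) && (v \in flabels (drop k ts)))
      (iota 0 (size ts)).

(* u is to the left of v, for T with pairwise distinct labels: u and v belong *)
(* to the subtrees at two distinct children of a vertex, that of u first      *)
Definition tree_left t u v : bool :=
  has (fun s => forest_left (children s) u v) (subtrees t).

Lemma forest_leftP ts u v :
  reflect (exists ts1 ts2, [/\ ts = ts1 ++ ts2, u \in flabels ts1 &
             v \in flabels ts2]) (forest_left ts u v).
Proof.
apply: (iffP hasP) => [[k _ /andP [hu hv]]|[ts1 [ts2 [-> hu hv]]]].
  by exists (take k ts), (drop k ts); rewrite cat_take_drop.
exists (size ts1); last by rewrite take_size_cat // drop_size_cat // hu hv.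
rewrite mem_iota add0n size_cat /=; case: ts2 hv => // t ts2 _ /=; lia.
Qed.

Lemma tree_ltP t u v :
  reflect (u != v /\ exists2 s, s \in subtrees t & root s = u /\ v \in labels s)
    (tree_lt t u v).
Proof.
apply: (iffP andP) => -[-> h]; split=> //.
  by case/hasP: h => s hs /andP [/eqP ? ?]; exists s.
by case: h => s hs [<- hv]; apply/hasP; exists s; rewrite ?eqxx.
Qed.

Lemma flabelsP ts u :
  reflect (exists2 t, t \in ts & u \in labels t) (u \in flabels ts).
Proof. exact: flatten_mapP. Qed.

Lemma flabels_cat ts ts' : flabels (ts ++ ts') = flabels ts ++ flabels ts'.
Proof. by rewrite /flabels map_cat flatten_cat. Qed.

Lemma subtrees_refl t : t \in subtrees t.
Proof. by case: t => a ts; rewrite inE eqxx. Qed.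

Lemma root_labels t : root t \in labels t.
Proof. by case: t => a ts; rewrite inE eqxx. Qed.

Lemma labelsE t : labels t = root t :: flabels (children t).
Proof. by case: t. Qed.

Lemma subtreesP s a ts :
  reflect (s = PNode a ts \/ exists2 t, t \in ts & s \in subtrees t)
    (s \in subtrees (PNode a ts)).
Proof.
rewrite inE; apply: (iffP predU1P) => -[->|h]; by [left|right; apply/flatten_mapP].
Qed.

Lemma subtrees_trans t s r :
  s \in subtrees t -> r \in subtrees s -> r \in subtrees t.
Proof.
elim/ptree_ind_mem: t => a ts IH /subtreesP [->//|[t ht hs]] hr.
by apply/subtreesP; right; exists t => //; apply: IH.
Qed.

Lemma subseq_flabels t ts : t \in ts -> subseq (labels t) (flabels ts).
Proof.
elim: ts => // t' ts IH; rewrite inE => /predU1P [->|/IH h].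
  exact: prefix_subseq.
exact: subseq_trans h (suffix_subseq _ _).
Qed.

Lemma subseq_labels t s : s \in subtrees t -> subseq (labels s) (labels t).
Proof.
elim/ptree_ind_mem: t => a ts IH /subtreesP [->//|[t ht hs]].
apply: subseq_trans (IH _ ht hs) _.
exact: subseq_trans (subseq_flabels ht) (subseq_cons _ _).
Qed.

Lemma tree_lt_subseq t u v : tree_lt t u v -> subseq [:: u; v] (labels t).
Proof.
case/tree_ltP => ne [s hs [hr hv]]; apply: subseq_trans (subseq_labels hs).
move: hv; rewrite labelsE hr inE eq_sym (negbTE ne) /= eqxx => hv.
by rewrite sub1seq.
Qed.

Lemma tree_left_subseq t u v : tree_left t u v -> subseq [:: u; v] (labels t).
Proof.
case/hasP => s hs /forest_leftP [ts1 [ts2 [h hu hv]]].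
apply: subseq_trans (subseq_labels hs); rewrite labelsE h flabels_cat.
apply: subseq_trans (subseq_cons _ _).
by rewrite -(cat1s u) cat_subseq ?sub1seq.
Qed.

Lemma uniq_subseq2 (s : seq A) u v :
  uniq s -> subseq [:: u; v] s -> subseq [:: v; u] s -> False.
Proof.
elim: s => //= a s IH /andP [ha hs].
case: (eqVneq u a) => [->|nu]; case: (eqVneq v a) => [->|nv].
- by rewrite sub1seq (negbTE ha).
- by move=> _ /mem_subseq /(_ a); rewrite !inE eqxx orbT (negbTE ha) => /(_ isT).
- by move=> /mem_subseq /(_ a); rewrite !inE eqxx orbT (negbTE ha) => /(_ isT).
- exact: IH.
Qed.

Lemma uniq_flabels_cat ts1 ts2 u :
  uniq (flabels (ts1 ++ ts2)) -> u \in flabels ts1 -> u \in flabels ts2 -> False.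
Proof.
by rewrite flabels_cat cat_uniq => /and3P [_ /hasPn h _] h1 /h; rewrite /= h1.
Qed.

Lemma uniq_flabels_mem ts t1 t2 u : uniq (flabels ts) ->
  t1 \in ts -> t2 \in ts -> u \in labels t1 -> u \in labels t2 -> t1 = t2.
Proof.
elim: ts => // t ts IH un; rewrite !inE => h1 h2 u1 u2.
have un' : uniq (flabels ts) by move: un; rewrite /= cat_uniq => /and3P [].
have dis x : x \in labels t -> x \in flabels ts -> False.
  move=> xt xts; apply: (@uniq_flabels_cat [:: t] ts x un) => //.
  by rewrite /flabels /= cats0.
case/predU1P: h1 => [e1|h1]; case/predU1P: h2 => [e2|h2]; subst => //.
- by case: (dis u u1); apply/flabelsP; exists t2.
- by case: (dis u u2); apply/flabelsP; exists t1.
- exact: IH.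
Qed.

Lemma tree_ltN_left t u v : uniq (labels t) ->
  tree_lt t u v -> tree_left t u v -> False.
Proof.
elim/ptree_ind_mem: t => a ts IH /= /andP [ha un].
case/tree_ltP => ne [s hs [hr hv]] /hasP [s' hs'] hl.
have us' : u \in flabels (children s') /\ v \in flabels (children s').
  case/forest_leftP: hl => ts1 [ts2 [-> h1 h2]].
  by rewrite flabels_cat !mem_cat h1 h2 orbT.
have hu t : t \in ts -> s' \in subtrees t -> u \in labels t /\ v \in labels t.
  move=> ht h; have := mem_subseq (subseq_labels h); rewrite labelsE => sub.
  by case: us' => h1 h2; split; apply: sub; rewrite inE ?h1 ?h2 orbT.
case/subtreesP: hs => [es|[t ht hs]].
  move: hr; rewrite es /= => ea; subst u.
  case/subtreesP: hs' => [es'|[t ht h]].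
    by case: us'; rewrite es' /= => h; case/negP: ha.
  by case: (hu _ ht h) => h1 _; case/negP: ha; apply/flabelsP; exists t.
have hut : u \in labels t.
  by apply: (mem_subseq (subseq_labels hs)); rewrite -hr root_labels.
have hvt : v \in labels t by apply: (mem_subseq (subseq_labels hs)).
case/subtreesP: hs' => [es'|[t' ht' h]].
  move: hl; rewrite es' /= => /forest_leftP [ts1 [ts2 [e h1 h2]]].
  rewrite -/(flabels ts) e in un; move: ht; rewrite e mem_cat => /orP [] ht.
    by apply: (uniq_flabels_cat (u := v) un) => //; apply/flabelsP; exists t.
  by apply: (uniq_flabels_cat (u := u) un) => //; apply/flabelsP; exists t.
have [h1 _] := hu _ ht' h.
have et : t' = t by apply: (uniq_flabels_mem un) h1 hut.
subst t'; apply: (IH t ht).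
- exact: subseq_uniq (subseq_flabels ht) un.
- by apply/tree_ltP; split=> //; exists s.
- by apply/hasP; exists s'.
Qed.

Lemma tree_total t u v : u \in labels t -> v \in labels t -> 
  [\/ u = v, tree_lt t u v, tree_lt t v u |
      tree_left t u v \/ tree_left t v u].
Proof.
elim/ptree_ind_mem: t => a ts IH.
have [->|ne] := eqVneq u v; first by constructor 1.
rewrite !inE => /predU1P [->|hu] /predU1P [ev|hv].
- by rewrite ev; constructor 1.
- case: (eqVneq a v) => [->|nav]; first by constructor 1.
  constructor 2; apply/tree_ltP; split=> //.
  by exists (PNode a ts); rewrite ?subtrees_refl //= inE hv orbT.
- constructor 3; apply/tree_ltP; split; first by rewrite eq_sym.
  by exists (PNode a ts); rewrite ?subtrees_refl //= inE hu orbT.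
case/flabelsP: hu => t ht hu; case/flabelsP: hv => t' ht' hv.
have lift_left x y t0 : t0 \in ts -> tree_left t0 x y -> tree_left (PNode a ts) x y.
  move=> h /hasP [s hs hl]; apply/hasP; exists s => //.
  by apply/subtreesP; right; exists t0.
have lift_lt x y t0 : t0 \in ts -> tree_lt t0 x y -> tree_lt (PNode a ts) x y.
  move=> h /tree_ltP [nxy [s hs hl]]; apply/tree_ltP; split=> //.
  by exists s => //; apply/subtreesP; right; exists t0.
case: (eqVneq t t') => [et|net].
  subst t'; case: (IH t ht hu hv) => [|/(lift_lt _ _ _ ht)|/(lift_lt _ _ _ ht)|h].
  - by constructor 1.
  - by constructor 2.
  - by constructor 3.
  - by constructor 4; case: h => h; [left|right]; apply: lift_left h.
constructor 4; case/splitPr: {IH lift_left lift_lt} ht ht' => ts1 ts2.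
have top x y : forest_left (ts1 ++ t :: ts2) x y ->
    tree_left (PNode a (ts1 ++ t :: ts2)) x y.
  by move=> h; apply/hasP; exists (PNode a (ts1 ++ t :: ts2)); rewrite ?subtrees_refl.
rewrite mem_cat inE eq_sym (negbTE net) /= => /orP [] h.
  right; apply: top; apply/forest_leftP; exists ts1, (t :: ts2); split=> //.
    by apply/flabelsP; exists t'.
  by apply/flabelsP; exists t => //; rewrite mem_head.
left; apply: top; apply/forest_leftP; exists (rcons ts1 t), ts2.
rewrite cat_rcons; split=> //; apply/flabelsP; last by exists t'.
by exists t => //; rewrite mem_rcons mem_head.
Qed.

End TreeRelations.

Section TreeMap.
Variables (A B : eqType) (f : A -> B).

Lemma tmap_labels t : labels (tmap f t) = map f (labels t).
Proof.
elim/ptree_ind_mem: t => a ts IH /=; congr (_ :: _).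
rewrite map_flatten -!map_comp; congr flatten.
by apply/eq_in_map => t /IH.
Qed.

Lemma tmap_flabels ts : flabels (map (tmap f) ts) = map f (flabels ts).
Proof.
rewrite /flabels map_flatten -!map_comp; congr flatten.
by apply/eq_in_map => t _ /=; rewrite tmap_labels.
Qed.

Lemma tmap_subtrees t : subtrees (tmap f t) = map (tmap f) (subtrees t).
Proof.
elim/ptree_ind_mem: t => a ts IH /=; congr (_ :: _).
rewrite map_flatten -!map_comp; congr flatten.
by apply/eq_in_map => t /IH.
Qed.

Lemma tmap_lt t u v : injective f ->
  tree_lt t u v -> tree_lt (tmap f t) (f u) (f v).
Proof.
move=> fI /tree_ltP [ne [s hs [hr hv]]]; subst u; apply/tree_ltP.
rewrite (inj_eq fI); split; first by [].
exists (tmap f s); first by rewrite tmap_subtrees map_f.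
by rewrite tmap_labels map_f //; case: (s) => a ts.
Qed.

Lemma tmap_left t u v : tree_left t u v -> tree_left (tmap f t) (f u) (f v).
Proof.
case/hasP => s hs /forest_leftP [ts1 [ts2 [e hu hv]]].
apply/hasP; exists (tmap f s); first by rewrite tmap_subtrees map_f.
apply/forest_leftP; exists (map (tmap f) ts1), (map (tmap f) ts2).
rewrite !tmap_flabels !map_f //; split=> //.
by case: s hs e => a ts _ /= ->; rewrite map_cat.
Qed.

End TreeMap.

Section Contract.
Variables (A B : eqType) (b : A -> B).

(* the tree obtained from t by relabelling along b and then contracting the   *)
(* edges whose two ends carry the same label; the children of a contracted    *)
(* vertex take its place among those of its parent                            *)
Fixpoint contract (t : ptree A) : ptree B :=
  let: PNode a ts := t in
  PNode (b a) (flatten [seq (let t' := contract t0 in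
                  if root t' == b a then children t' else [:: t']) | t0 <- ts]).

Let splice a t := if root (contract t) == b a then children (contract t)
                  else [:: contract t].

Lemma contractE a ts :
  contract (PNode a ts) = PNode (b a) (flatten (map (splice a) ts)).
Proof. by []. Qed.

Lemma labels_splice a t u : u \in labels (contract t) ->
  u = b a \/ u \in flabels (splice a t).
Proof.
rewrite /splice; case: eqP => [e|_]; last first.
  by move=> h; right; rewrite /flabels /= cats0.
by rewrite labelsE e inE => /predU1P.
Qed.

Lemma flabels_splice a ts u : u \in flabels (map contract ts) ->
  u = b a \/ u \in flabels (flatten (map (splice a) ts)).
Proof.
elim: ts => //= t ts IH; rewrite flabels_cat mem_cat {1}/flabels /= mem_cat.
case/orP => [/(labels_splice a) [|h]|/IH [|h]]; [by left| |by left|];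
  by right; rewrite ?h // orbT.
Qed.

Lemma labels_contract t v : v \in labels t -> b v \in labels (contract t).
Proof.
elim/ptree_ind_mem: t v => a ts IH v.
rewrite contractE !inE => /predU1P [->|h]; first by rewrite eqxx.
have : b v \in flabels (map contract ts).
  case/flabelsP: h => t ht hv; apply/flabelsP.
  by exists (contract t); [exact: map_f | exact: IH].
by case/(flabels_splice a) => [->|/= h']; rewrite ?eqxx // h' orbT.
Qed.

Lemma flabels_contract ts v :
  v \in flabels ts -> b v \in flabels (map contract ts).
Proof.
case/flabelsP => t ht hv; apply/flabelsP.
by exists (contract t); [exact: map_f | exact: labels_contract].
Qed.

Lemma contract_lt_child a ts t x y : t \in ts ->
  tree_lt (contract t) x y -> tree_lt (contract (PNode a ts)) x y.
Proof.
move=> ht /tree_ltP [ne [s hs [hr hy]]]; apply/tree_ltP; split=> //.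
have [e|e] := eqVneq (root (contract t)) (b a); last first.
  exists s => //; rewrite contractE; apply/subtreesP; right.
  exists (contract t) => //; apply/flatten_mapP; exists t => //.
  by rewrite /splice (negbTE e) mem_head.
have kid t0 : t0 \in children (contract t) ->
    t0 \in flatten (map (splice a) ts).
  by move=> h; apply/flatten_mapP; exists t => //; rewrite /splice e eqxx.
case E: (contract t) => [c cs]; move: hs; rewrite E => /subtreesP [es|[t0 ht0 hs]].
  exists (contract (PNode a ts)); first exact: subtrees_refl.
  subst s; rewrite /= in hr; subst c.
  rewrite contractE -[b a]e E /=; split=> //.
  move: hy; rewrite /= !inE => /predU1P [yc|/flabelsP [t1 h1 h2]].
    by rewrite yc eqxx in ne.
  apply/orP; right; apply/flabelsP; exists t1 => //; apply: kid.
  by rewrite E.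
exists s => //; rewrite contractE; apply/subtreesP; right; exists t0 => //.
by apply: kid; rewrite E.
Qed.

Lemma contract_left_child a ts t x y : t \in ts ->
  tree_left (contract t) x y -> tree_left (contract (PNode a ts)) x y.
Proof.
move=> ht /hasP [s hs hl].
have [e|e] := eqVneq (root (contract t)) (b a); last first.
  apply/hasP; exists s => //; rewrite contractE; apply/subtreesP; right.
  exists (contract t) => //; apply/flatten_mapP; exists t => //.
  by rewrite /splice (negbTE e) mem_head.
case E: (contract t) => [c cs]; move: hs; rewrite E => /subtreesP [es|[t0 ht0 hs]].
  apply/hasP; exists (contract (PNode a ts)); first exact: subtrees_refl.
  rewrite contractE; case/splitPr: ht => ts1 ts2.
  rewrite map_cat flatten_cat /= {2}/splice e eqxx E /=.
  move: hl; rewrite es /= => /forest_leftP [l1 [l2 [-> h1 h2]]].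
  apply/forest_leftP; exists (flatten (map (splice a) ts1) ++ l1).
  exists (l2 ++ flatten (map (splice a) ts2)).
  by rewrite -!catA !flabels_cat !mem_cat h1 h2 orbT.
apply/hasP; exists s => //; rewrite contractE; apply/subtreesP; right.
exists t0 => //; apply/flatten_mapP; exists t => //.
by rewrite /splice e eqxx E.
Qed.

Lemma contract_lt t u v : b u != b v ->
  tree_lt t u v -> tree_lt (contract t) (b u) (b v).
Proof.
move=> ne; elim/ptree_ind_mem: t => a ts IH /tree_ltP [nuv [s hs [hr hv]]].
case/subtreesP: hs => [es|[t ht hs]].
  subst s; rewrite /= in hr; subst u; apply/tree_ltP; split=> //.
  exists (contract (PNode a ts)); first exact: subtrees_refl.
  by split=> //; apply: labels_contract.
apply: (@contract_lt_child a ts t) => //; apply: IH => //.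
by apply/tree_ltP; split=> //; exists s.
Qed.

Lemma contract_left t u v : b u != b v -> tree_left t u v ->
  [\/ tree_left (contract t) (b u) (b v), tree_lt (contract t) (b u) (b v) |
      tree_lt (contract t) (b v) (b u)].
Proof.
move=> ne; elim/ptree_ind_mem: t => a ts IH /hasP [s hs hl].
case/subtreesP: hs => [es|[t ht hs]]; last first.
  have : tree_left t u v by apply/hasP; exists s.
  case/(IH t ht) => h; [constructor 1|constructor 2|constructor 3];
    by [apply: (contract_left_child _ ht) | apply: (contract_lt_child _ ht)].
move: hl; rewrite es /= => /forest_leftP [ts1 [ts2 [e hu hv]]].
have hu' := flabels_contract hu; have hv' := flabels_contract hv.
have inF x l : x \in flabels (flatten (map (splice a) l)) ->
    {subset l <= ts} -> x \in labels (contract (PNode a ts)).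
  move=> h sub; rewrite contractE inE; apply/orP; right.
  case/flabelsP: h => t0 /flatten_mapP [t1 /sub h1 h0] hx; apply/flabelsP.
  by exists t0 => //; apply/flatten_mapP; exists t1.
have s1 : {subset ts1 <= ts} by move=> t0 h; rewrite e mem_cat h.
have s2 : {subset ts2 <= ts} by move=> t0 h; rewrite e mem_cat h orbT.
case/(flabels_splice a): hu' => [eu|hu']; case/(flabels_splice a): hv' => [ev|hv'].
- by rewrite eu ev eqxx in ne.
- constructor 2; apply/tree_ltP; split=> //.
  exists (contract (PNode a ts)); first exact: subtrees_refl.
  by split; [rewrite eu | apply: inF hv' s2].
- constructor 3; apply/tree_ltP; split; first by rewrite eq_sym.
  exists (contract (PNode a ts)); first exact: subtrees_refl.
  by split; [rewrite ev | apply: inF hu' s1].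
constructor 1; apply/hasP; exists (contract (PNode a ts)).
  exact: subtrees_refl.
rewrite contractE /= e map_cat flatten_cat; apply/forest_leftP.
by exists (flatten (map (splice a) ts1)), (flatten (map (splice a) ts2)).
Qed.

End Contract.

Section Prune.
Variables (A : eqType) (P : pred A).

(* t without the subtrees whose root is not in P *)
Fixpoint prune (t : ptree A) : ptree A :=
  let: PNode a ts := t in
  PNode a (flatten [seq (if P (root t0) then [:: prune t0] else [::]) | t0 <- ts]).

Let keep t := if P (root t) then [:: prune t] else [::].

Lemma pruneE a ts : prune (PNode a ts) = PNode a (flatten (map keep ts)).
Proof. by []. Qed.

Lemma root_prune t : root (prune t) = root t.
Proof. by case: t. Qed.

Lemma keepP t s : reflect (P (root t) /\ s = prune t) (s \in keep t).
Proof.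
rewrite /keep; case: ifP => h; last by constructor => -[].
by rewrite inE; apply: (iffP eqP) => [|[]].
Qed.

Lemma prune_labels t : {subset labels (prune t) <= labels t}.
Proof.
elim/ptree_ind_mem: t => a ts IH x; rewrite pruneE !inE.
case/orP => [->//|/flabelsP [s /flatten_mapP [t ht /keepP [_ ->]] hx]].
by apply/orP; right; apply/flabelsP; exists t => //; apply: IH.
Qed.

Lemma prune_flabels ts :
  {subset flabels (flatten (map keep ts)) <= flabels ts}.
Proof.
move=> x /flabelsP [s /flatten_mapP [t ht /keepP [_ ->]] hx].
by apply/flabelsP; exists t => //; apply: prune_labels.
Qed.

Lemma prune_subtrees t s : s \in subtrees (prune t) ->
  exists2 r, r \in subtrees t & s = prune r.
Proof.
elim/ptree_ind_mem: t => a ts IH; rewrite pruneE => /subtreesP [->|].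
  by exists (PNode a ts); rewrite ?subtrees_refl.
case=> s' /flatten_mapP [t ht /keepP [_ ->]] /(IH t ht) [r hr ->].
by exists r => //; apply/subtreesP; right; exists t.
Qed.

Lemma keep_split ts l1 l2 : flatten (map keep ts) = l1 ++ l2 ->
  exists ts1 ts2, [/\ ts = ts1 ++ ts2, l1 = flatten (map keep ts1) &
                      l2 = flatten (map keep ts2)].
Proof.
elim: ts l1 => [|t ts IH] l1 /=.
  by case: l1 => //= <-; exists [::], [::].
case: l1 => [/= <-|s l1]; first by exists [::], (t :: ts).
rewrite /keep -/keep; case: ifP => ht /=.
  case=> es /IH [ts1 [ts2 [-> -> ->]]]; exists (t :: ts1), ts2.
  by rewrite /= {2}/keep ht es.
move=> /(IH (s :: l1)) [ts1 [ts2 [-> -> ->]]]; exists (t :: ts1), ts2.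
by rewrite /= {2}/keep ht.
Qed.

Lemma prune_lt t u v : tree_lt (prune t) u v -> tree_lt t u v.
Proof.
case/tree_ltP => ne [s /prune_subtrees [r hr ->] [e hv]].
apply/tree_ltP; split=> //; exists r => //; rewrite -e root_prune; split=> //.
exact: prune_labels.
Qed.

Lemma prune_left t u v : tree_left (prune t) u v -> tree_left t u v.
Proof.
case/hasP => s /prune_subtrees [[a ts] hr ->].
rewrite pruneE /= => /forest_leftP [l1 [l2 [/keep_split]]].
case=> ts1 [ts2 [e -> ->]] hu hv; apply/hasP; exists (PNode a ts) => //.
by apply/forest_leftP; exists ts1, ts2; split=> //; apply: prune_flabels.
Qed.

End Prune.

Lemma subtree_lt (A : eqType) (t s : ptree A) u v :
  s \in subtrees t -> tree_lt s u v -> tree_lt t u v.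
Proof.
move=> hs /tree_ltP [ne [r hr h]]; apply/tree_ltP; split=> //.
by exists r => //; apply: subtrees_trans hr.
Qed.

Lemma subtree_left (A : eqType) (t s : ptree A) u v :
  s \in subtrees t -> tree_left s u v -> tree_left t u v.
Proof.
move=> hs /hasP [r hr h]; apply/hasP; exists r => //.
exact: subtrees_trans hr.
Qed.

Record tree n := Tree {
  tree_val :> ptree 'I_n;
  tree_valP : perm_eq (labels tree_val) (enum 'I_n)
}.
HB.instance Definition _ n := [isSub for @tree_val n].
HB.instance Definition _ n := [Countable of tree n by <:].

Fixpoint lists_upto (X : Type) (s : seq X) k : seq (seq X) :=
  if k is k'.+1
  then [::] :: [seq x :: l | x <- s, l <- lists_upto s k'] else [:: [::]].

Fixpoint ptrees_upto n h : seq (ptree 'I_n) :=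
  if h is h'.+1
  then [seq PNode a ts | a <- enum 'I_n, ts <- lists_upto (ptrees_upto n h') n]
  else [::].

Lemma mem_lists_upto (X : eqType) (s : seq X) k l :
  (size l <= k)%N -> {subset l <= s} -> l \in lists_upto s k.
Proof.
elim: k l => [|k IH] [|x l] //= hl sub; rewrite inE; apply/orP; right.
apply/allpairsP; exists (x, l); split=> //=; first by apply: sub; rewrite mem_head.
by apply: IH => // y hy; apply: sub; rewrite inE hy orbT.
Qed.

Lemma mem_ptrees_upto n h (t : ptree 'I_n) :
  (size (labels t) <= h)%N -> (size (labels t) <= n)%N -> t \in ptrees_upto n h.
Proof.
elim: h t => [|h IH] [a ts] // h1 h2.
rewrite labelsE /= in h1 h2; apply/allpairsP; exists (a, ts); split=> //=; first by rewrite mem_enum.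
have sz : (size ts <= size (flabels ts))%N.
  rewrite /flabels; elim: (ts) => //= t ts' IHts; rewrite size_cat.
  have : (0 < size (labels t))%N by case: (t).
  by move: IHts; lia.
have le t : t \in ts -> (size (labels t) <= size (flabels ts))%N.
  by move=> /subseq_flabels /size_subseq.
apply: mem_lists_upto; first exact: leq_trans sz (ltnW h2).
move=> t /le ht; apply: IH; first exact: leq_trans ht h1.
exact: leq_trans ht (ltnW h2).
Qed.

Definition tree_enum n : seq (tree n) := undup (pmap insub (ptrees_upto n n)).

Fact tree_enumP n : Finite.axiom (tree_enum n).
Proof.
move=> t; rewrite count_uniq_mem ?undup_uniq // mem_undup mem_pmap_sub.
rewrite mem_ptrees_upto // (perm_size (tree_valP t)) -cardE card_ord //.
Qed.
HB.instance Definition _ n := isFinite.Build (tree n) (@tree_enumP n).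

Lemma mem_tree n (t : tree n) a : a \in labels t.
Proof. by rewrite (perm_mem (tree_valP t)) mem_enum. Qed.

Lemma tree_uniq n (t : tree n) : uniq (labels t).
Proof. by rewrite (perm_uniq (tree_valP t)) enum_uniq. Qed.

Fact tree_perm_subproof n (s : 'S_n) (t : tree n) :
  perm_eq (labels (tmap s t)) (enum 'I_n).
Proof.
rewrite tmap_labels uniq_perm ?enum_uniq ?map_inj_uniq ?tree_uniq //.
  exact: perm_inj.
move=> a; rewrite mem_enum; apply/mapP; exists (s^-1%g a); rewrite ?mem_tree //.
by rewrite permKV.
Qed.

Definition tree_perm n (s : 'S_n) (t : tree n) : tree n :=
  Tree (tree_perm_subproof s t).

Fact tree_one_subproof : perm_eq (labels (PNode (ord0 : 'I_1) [::])) (enum 'I_1).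
Proof. by rewrite enum_ordSl /= enum_ord0. Qed.

Definition tree_one : tree 1 := Tree tree_one_subproof.

(* U \in Ext(T, T', i) *)
Definition tree_ext m n (i : 'I_m.+1) (T : tree m.+1) (T' : tree n.+1)
    (U : tree (m + n).+1) : bool :=
  has (fun s => prune (block i) s == tmap (@alpha m n i) T') (subtrees U)
  && (contract (@beta m n i) U == T).

Section TreeExt.
Variables (m n : nat) (i : 'I_m.+1) (T : tree m.+1) (T' : tree n.+1).
Variable U : tree (m + n).+1.
Hypothesis UE : tree_ext i T T' U.
Let b := @beta m n i.
Let a := @alpha m n i.

Lemma tree_ext_lt_out u v : b u != b v -> tree_lt U u v -> tree_lt T (b u) (b v).
Proof. by case/andP: UE => _ /eqP <-; apply: contract_lt. Qed.

Lemma tree_ext_left_out u v :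
  b u != b v -> tree_left T (b u) (b v) -> tree_left U u v.
Proof.
move=> ne h; have TU := tree_uniq T.
have ne' : b v != b u by rewrite eq_sym.
have nlt x y : tree_left T x y -> tree_lt T x y -> False.
  by move=> h1 h2; apply: (tree_ltN_left TU h2 h1).
have nlt' x y : tree_left T x y -> tree_lt T y x -> False.
  by move=> /tree_left_subseq h1 /tree_lt_subseq h2; apply: (uniq_subseq2 TU h1 h2).
case: (tree_total (mem_tree U u) (mem_tree U v)) => [e|/(tree_ext_lt_out ne)|
  /(tree_ext_lt_out ne')|[//|h']].
- by rewrite e eqxx in ne.
- by move/(nlt _ _ h).
- by move/(nlt' _ _ h).
have [h1|h1|h1] := contract_left ne' h'; move: h1;
  case/andP: UE => _ /eqP -> h1.
- by case: (uniq_subseq2 TU (tree_left_subseq h) (tree_left_subseq h1)).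
- by case: (nlt' _ _ h h1).
- by case: (nlt _ _ h h1).
Qed.

Lemma tree_ext_lt_in u v : tree_lt T' u v -> tree_lt U (a u) (a v).
Proof.
case/andP: UE => /hasP [s hs /eqP e] _ h.
apply: (subtree_lt hs); apply: (@prune_lt _ (block i)); rewrite e.
by apply: tmap_lt => //; apply: alpha_inj.
Qed.

Lemma tree_ext_left_in u v : tree_left T' u v -> tree_left U (a u) (a v).
Proof.
case/andP: UE => /hasP [s hs /eqP e] _ h.
apply: (subtree_left hs); apply: (@prune_left _ (block i)); rewrite e.
exact: tmap_left.
Qed.

Lemma tree_ext_lt_inV u v : tree_lt U (a u) (a v) -> tree_lt T' u v.
Proof.
move=> h; have UU := tree_uniq U.
case: (tree_total (mem_tree T' u) (mem_tree T' v)) => [e|//|/tree_ext_lt_in h'|h'].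
- by case/tree_ltP: h; rewrite e eqxx.
- by case: (uniq_subseq2 UU (tree_lt_subseq h) (tree_lt_subseq h')).
case: h' => /tree_ext_left_in h'; first by case: (tree_ltN_left UU h h').
by case: (uniq_subseq2 UU (tree_lt_subseq h) (tree_left_subseq h')).
Qed.

End TreeExt.

Section Words.
Variable A : eqType.
Implicit Types (W : seq A) (u v a b : A).

Notation letter W := (tnth (in_tuple W)).

(* W = ... u ... v ... u ... *)
Definition word_lt W u v : bool := (u != v) && subseq [:: u; v; u] W.

Definition word_left W u v : bool :=
  [forall p : 'I_(size W), forall q : 'I_(size W),
    (letter W p == u) ==> (letter W q == v) ==> (p < q)%N].

Definition caesura W (p : 'I_(size W)) : bool := letter W p \in drop p.+1 W.

(* W = ... b a ... b ... *)
Definition interposed W a : bool :=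
  [exists p : 'I_(size W), exists q : 'I_(size W),
    [&& q == p.+1 :> nat, letter W q == a & letter W p \in drop q.+1 W]].

Definition delete (p : nat) W : seq A := take p W ++ drop p.+1 W.

(* deletion of adjacent repetitions *)
Fixpoint destutter W : seq A :=
  if W is a :: W' then
    if ohead W' == Some a then destutter W' else a :: destutter W'
  else [::].

(* For a caesura p, the number of caesuras up to p is its rank j; for a last  *)
(* occurrence p of a repeated letter, the caesuras up to the previous         *)
(* occurrence of that letter are those up to some earlier occurrence.         *)
Definition sgn_del W (p : 'I_(size W)) : int :=
  if caesura p then
    (-1) ^+ #|[set q : 'I_(size W) | caesura q & (q <= p)%N]|
  else
    (-1) ^+ #|[set q : 'I_(size W) | caesura q &
       [exists r : 'I_(size W),
          [&& (q <= r)%N, (r < p)%N & letter W r == letter W p]]]|.+1.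

Lemma subseq2P W u v :
  reflect (exists p q : 'I_(size W), [/\ (p < q)%N, letter W p = u & letter W q = v])
    (subseq [:: u; v] W).
Proof.
apply: (iffP idP) => [|[p [q [pq <- <-]]]].
  case/subseqP => M szM e; move: e szM.
  elim: W M => [|a W IH] [|[] M] //=.
  - case=> <- e [szM]; have : v \in W.
      by rewrite (mem_subseq (mask_subseq M W)) // -e mem_head.
    move=> vW; have lt : ((index v W).+1 < (size W).+1)%N by rewrite ltnS index_mem.
    exists (Ordinal (ltn0Sn (size W))), (Ordinal lt); split=> //.
    by rewrite (tnth_nth v) /= nth_index.
  - move=> e [szM]; have [p [q [pq <- <-]]] := IH M e szM.
    exists (lift ord0 p), (lift ord0 q); split=> //.
    + by rewrite !(tnth_nth a).
    + by rewrite !(tnth_nth a).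
rewrite -[X in subseq _ X](cat_take_drop q).
have h x (r : 'I_(size W)) : letter W r = nth x W r by rewrite (tnth_nth x).
rewrite -(cat1s (letter W p)) cat_subseq // sub1seq.
  rewrite (h (letter W p)) -(nth_take _ pq) mem_nth //.
  by rewrite size_takel // ltnW.
rewrite (h (letter W p)) -[q in nth _ _ q]addn0 -nth_drop mem_nth //.
by rewrite size_drop subn_gt0.
Qed.

Lemma word_leftP W u v : u \in W ->
  word_left W u v = (u != v) && ~~ subseq [:: v; u] W.
Proof.
move=> uW; apply/idP/idP.
  move=> /forallP h; apply/andP; split.
    apply/eqP => e; subst v.
    have lt : (index u W < size W)%N by rewrite index_mem.
    move/forallP: (h (Ordinal lt)) => /(_ (Ordinal lt)).
    by rewrite (tnth_nth u) /= nth_index // eqxx ltnn.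
  apply/subseq2P => -[p [q [pq ep eq]]].
  by move/forallP: (h q) => /(_ p); rewrite ep eq !eqxx /= ltnNge ltnW.
case/andP => ne /subseq2P h; apply/forallP => p; apply/forallP => q.
apply/implyP => /eqP ep; apply/implyP => /eqP eq; rewrite ltnNge leq_eqVlt.
apply/negP => /orP [/eqP /val_inj e|qp]; first by rewrite -ep -eq e eqxx in ne.
by apply: h; exists q, p.
Qed.

Lemma destutter_cons a W : destutter (a :: W) =
  if ohead W == Some a then destutter W else a :: destutter W.
Proof. by []. Qed.

Lemma subseq_destutter s W : sorted (fun a b => a != b) s ->
  subseq s W -> subseq s (destutter W).
Proof.
elim: W s => [|a W IH] s //; rewrite destutter_cons.
case: s => [|c s]; first by move=> _ _; apply: sub0seq.
rewrite [subseq _ (a :: W)]/=; case: (eqVneq c a) => [->|nc] srt h; last first.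
  by case: ifP => _; [|apply: (subseq_trans _ (subseq_cons _ _))]; apply: IH.
have srt' : sorted (fun a b => a != b) s by apply: path_sorted srt.
case: ifP => [hd|_]; last by rewrite /= eqxx; apply: IH.
apply: IH => //; case: W hd h => //= c' W /eqP [->]; rewrite eqxx.
case: s srt {srt'} => [|d s] /=; first by rewrite sub0seq.
case/andP=> nd _; by rewrite eq_sym (negbTE nd).
Qed.

Lemma sorted_delete (s t : seq A) u :
  sorted (fun a b => a != b) (s ++ u :: t) -> u \in s ++ t ->
  (forall x y, x != y -> ~~ subseq [:: x; y; x; y] (s ++ u :: t)) ->
  sorted (fun a b => a != b) (s ++ t).
Proof.
case: t => [|y t].
  by case: s => //= a s; rewrite cats0 cat_path => /andP [].
case/lastP: s => [|s x]; first by move=> /path_sorted.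
rewrite !cat_rcons !sorted_cat_cons /= => /and4P [-> xu uy ->] hu no.
rewrite andbT; apply/eqP => exy; subst y; move: hu; rewrite mem_cat !inE.
rewrite (negbTE uy) /= => /orP [] hu.
  case/negP: (no u x uy); rewrite -(cat1s u) cat_subseq ?sub1seq //=.
  by rewrite !eqxx sub0seq.
case/negP: (no x u xu); apply: subseq_trans (suffix_subseq s _).
by rewrite /= !eqxx sub1seq.
Qed.

End Words.

Lemma subseq_map_inj (A B : eqType) (f : A -> B) s t : injective f ->
  subseq (map f s) (map f t) = subseq s t.
Proof.
move=> fI; elim: t s => [|y t IH] [|x s] //=.
by rewrite (inj_eq fI) -IH; case: ifP.
Qed.

Definition is_fword n (W : seq 'I_n) : bool :=
  [&& [forall u, u \in W], sorted (fun u v => u != v) W &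
    [forall u, forall v, (u != v) ==> ~~ subseq [:: u; v; u; v] W]].

Record fword n := FWord { fword_val :> seq 'I_n; fword_valP : is_fword fword_val }.
HB.instance Definition _ n := [isSub for @fword_val n].
HB.instance Definition _ n := [Choice of fword n by <:].

Lemma is_fwordP n (W : seq 'I_n) :
  reflect [/\ forall u, u \in W, sorted (fun u v => u != v) W &
            forall u v, u != v -> ~~ subseq [:: u; v; u; v] W] (is_fword W).
Proof.
apply: (iffP and3P) => -[h1 h2 h3]; split=> //.
- exact/forallP.
- by move=> u v; move/forallP: h3 => /(_ u) /forallP /(_ v) /implyP.
- exact/forallP.
- by apply/forallP => u; apply/forallP => v; apply/implyP/h3.
Qed.

Lemma mem_fword n (W : fword n) u : u \in fword_val W.
Proof. by case/is_fwordP: (fword_valP W). Qed.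

Lemma delete_fword n (W : fword n) (p : 'I_(size W)) :
  is_fword (delete p W) = (1 < count_mem (tnth (in_tuple W) p) W)%N.
Proof.
set u := tnth _ p; have eu : nth u W p = u by rewrite [RHS](tnth_nth u).
have eW : fword_val W = take p W ++ u :: drop p.+1 W.
  by rewrite -[in LHS](cat_take_drop p W) (drop_nth u) // eu.
have -> : (1 < count_mem u W)%N = (u \in delete p W).
  rewrite {1}eW count_cat /= eqxx addnCA add1n ltnS -count_cat -has_count.
  by rewrite has_pred1.
apply/idP/idP => [/is_fwordP [h _ _]|hu]; first exact: h.
have [h1 h2 h3] := is_fwordP _ (fword_valP W).
have sub : subseq (delete p W) W.
  by rewrite [X in subseq _ X]eW /delete cat_subseq // subseq_cons.
apply/is_fwordP; split.
- move=> v; have := h1 v; rewrite {1}eW /delete !mem_cat inE.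
  case: (eqVneq v u) => [->|//] _; by move: hu; rewrite mem_cat.
- apply: (@sorted_delete _ _ _ u); rewrite -?eW //.
- by move=> x y ne; apply: contra (h3 x y ne) => h; apply: subseq_trans h sub.
Qed.

(* d_p W: by delete_fword, this is the word W without its p-th letter if that *)
(* letter occurs at least twice, and 0 otherwise                              *)
Definition fword_del n (W : fword n) (p : 'I_(size W)) : {malg int[fword n]} :=
  if insub (delete p W) is Some V then << V >> else 0.

Definition fword_d n (W : fword n) : {malg int[fword n]} :=
  \sum_(p < size W) sgn_del p *: fword_del p.

Definition fword_deg n (W : fword n) : int := n%:Z - (size W)%:Z.

Fact fword_perm_subproof n (s : 'S_n) (W : fword n) : is_fword (map s W).
Proof.
have [h1 h2 h3] := is_fwordP _ (fword_valP W); apply/is_fwordP; split.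
- move=> u; apply/mapP; exists (s^-1%g u) => //; by rewrite permKV.
- rewrite sorted_map (eq_sorted (e' := fun u v => u != v)) // => u v /=.
  by rewrite (inj_eq perm_inj).
move=> u v ne; rewrite -[u](permKV s) -[v](permKV s) -/(map s [:: _; _; _; _]).
rewrite (subseq_map_inj [:: _; _; _; _]); last exact: perm_inj.
by apply: h3; rewrite (inj_eq perm_inj).
Qed.

Definition fword_perm n (s : 'S_n) (W : fword n) : fword n :=
  FWord (fword_perm_subproof s W).

Fact fword_one_subproof : is_fword [:: ord0 : 'I_1].
Proof.
apply/is_fwordP; split=> // [u|u v]; first by rewrite ord1 mem_head.
by rewrite !ord1 eqxx.
Qed.

Definition fword_one : fword 1 := FWord fword_one_subproof.

Section FWordComp.
Variables (m n : nat) (i : 'I_m.+1) (W : fword m.+1) (W' : fword n.+1).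

(* X \in Ext(W, W', i).  The condition on the length of X says that deg X =   *)
(* deg W + deg W'; without it, Ext(121, 12, 1) would contain 132 besides 1312 *)
(* and 1232 (letters numbered from 1).                                        *)
Definition word_ext (X : fword (m + n).+1) : bool :=
  [&& (size X).+1 == (size W + size W')%N,
      destutter (filter (block i) X) == map (@alpha m n i) W' &
      destutter (map (@beta m n i) X) == W].

Definition word_exts : seq (fword (m + n).+1) :=
  filter word_ext
    (pmap insub [seq tval t | t : (size W + size W').-1.-tuple 'I_(m + n).+1]).

Definition gamma (a : 'I_m.+1) : 'I_(m + n).+1 :=
  if a == i then alpha i (head ord0 W')
  else inord (if (a < i)%N then a : nat else (a + n)%N).

(* the number of inversions of the shuffle int(X) of gamma(int(W)) and        *)
(* alpha(int(W'))                                                             *)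
Definition shuffle_inv (X : fword (m + n).+1) : nat :=
  #|[set ab : 'I_m.+1 * 'I_n.+1 | [&& interposed W ab.1, interposed W' ab.2 &
       (index (alpha i ab.2) X < index (gamma ab.1) X)%N]]|.

Definition fword_comp : {malg int[fword (m + n).+1]} :=
  \sum_(X <- word_exts) (-1) ^+ shuffle_inv X *: << X >>.

End FWordComp.

Definition tree_comp m n (i : 'I_m.+1) (T : tree m.+1) (T' : tree n.+1) :
    {malg int[tree (m + n).+1]} :=
  \sum_(U | tree_ext i T T' U) << U >>.

Section WordExt.
Variables (m n : nat) (i : 'I_m.+1) (W : fword m.+1) (W' : fword n.+1).
Variable X : fword (m + n).+1.
Hypothesis XE : word_ext i W W' X.
Let b := @beta m n i.
Let a := @alpha m n i.

Lemma word_ext_subseq_out s : sorted (fun u v => u != v) (map b s) ->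
  subseq s X -> subseq (map b s) W.
Proof.
case/and3P: XE => _ _ /eqP <- srt h.
by apply: subseq_destutter => //; apply: map_subseq.
Qed.

Lemma word_ext_subseq_in s : sorted (fun u v => u != v) s ->
  subseq (map a s) X -> subseq s W'.
Proof.
case/and3P: XE => _ /eqP e _ srt h.
have aI : injective a by apply: alpha_inj.
rewrite -(subseq_map_inj _ _ aI) -e; apply: subseq_destutter.
  by rewrite sorted_map (eq_sorted (e' := fun u v => u != v)) // => u v /=;
    rewrite (inj_eq aI).
rewrite subseq_filter h andbT; apply/allP => _ /mapP [u _ ->].
by apply/blockP; exists u.
Qed.

End WordExt.

Definition Brace : dg_operad_data := {|
  op_mod n := {malg int[tree n.+1]};
  op_homog n k := fun x => (k == 0) || (x == 0);
  op_d n := fun=> 0;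
  op_act n x s := linext (fun T => << tree_perm s^-1%g T >>) x;
  op_one := << tree_one >>;
  op_comp m n i x y :=
    linext (fun T => linext (fun T' => tree_comp i T T') y) x
|}.

Definition pair_basis n : choiceType := (fword n.+1 * tree n.+1)%type.

(* The Hadamard product: Z[FWord] (x) Z[Tree] is Z[FWord x Tree].  No Koszul  *)
(* sign occurs, since Brace is concentrated in degree 0.                      *)
Definition F2Surj_Brace : dg_operad_data := {|
  op_mod n := {malg int[pair_basis n]};
  op_homog n k := fun x =>
    x \in supported (fun b : pair_basis n => fword_deg b.1 == k);
  op_d n := linext (fun b : pair_basis n => tens (fword_d b.1) << b.2 >>);
  op_act n x s := linext (fun b : pair_basis n =>
    << ((fword_perm s^-1%g b.1, tree_perm s^-1%g b.2) : pair_basis n) >>) x;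
  op_one := << ((fword_one, tree_one) : pair_basis 0) >>;
  op_comp m n i x y := linext (fun b : pair_basis m =>
    linext (fun c : pair_basis n =>
      tens (fword_comp i b.1 c.1) (tree_comp i b.2 c.2)) y) x
|}.

Definition is_quilt n (b : pair_basis n) : bool :=
  [forall u, forall v, (tree_lt b.2 u v ==> word_left b.1 u v) &&
                       (word_lt b.1 u v ==> tree_left b.2 v u)].

Lemma is_quiltP n (b : pair_basis n) : reflect
  (forall u v, (tree_lt b.2 u v -> ~~ subseq [:: v; u] b.1) /\
     (u != v -> subseq [:: u; v; u] b.1 -> tree_left b.2 v u))
  (is_quilt b).
Proof.
apply: (iffP forallP) => h u.
  move=> v; move/forallP: (h u) => /(_ v) /andP [/implyP h1 /implyP h2].
  split; first by move=> /h1; rewrite word_leftP ?mem_fword // => /andP [].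
  by move=> ne s; apply: h2; rewrite /word_lt ne.
apply/forallP => v; have [h1 h2] := h u v; apply/andP; split; apply/implyP.
  move=> lt; rewrite word_leftP ?mem_fword // h1 // andbT.
  by case/tree_ltP: lt.
by case/andP.
Qed.

Lemma supported_sum_basis (B I : choiceType) (P : pred B) (r : seq I)
    (Q : pred I) (c : I -> int) (f : I -> B) :
  (forall i, i \in r -> Q i -> P (f i)) ->
  \sum_(i <- r | Q i) c i *: << f i >> \in supported P.
Proof.
move=> h; rewrite big_seq_cond; apply: rpred_sum => j /andP [jr Qj].
by apply: supportedZ; apply: supportedU => _; apply: h.
Qed.

Lemma quilt_d_closed n (x : F2Surj_Brace n) :
  x \in supported (@is_quilt n) -> op_d F2Surj_Brace x \in supported (@is_quilt n).
Proof.
move=> hx; apply: (supported_linext hx) => -[W T] /is_quiltP /= q.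
apply: (@supported_tens _ _ (fun V : fword n.+1 => subseq V W) (pred1 T)).
- apply: rpred_sum => p _; apply: supportedZ; rewrite /fword_del.
  case: insubP => [V _ eV|_]; last exact: rpred0.
  apply: supportedU => _; rewrite eV -[X in subseq _ X](cat_take_drop p W).
  by rewrite cat_subseq // (drop_nth ord0) // subseq_cons.
- by apply: supportedU => _ /=.
move=> V _ sub /eqP ->; apply/is_quiltP => u v /=; have [h1 h2] := q u v.
split=> [/h1|ne h]; first by apply: contra => h; apply: subseq_trans sub.
by apply: h2 => //; apply: subseq_trans h sub.
Qed.

Lemma quilt_act_closed n (x : F2Surj_Brace n) (s : 'S_n.+1) :
  x \in supported (@is_quilt n) ->
  op_act F2Surj_Brace x s \in supported (@is_quilt n).
Proof.
move=> hx; apply: (supported_linext hx) => -[W T] /is_quiltP /= q.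
apply: supportedU => _; apply/is_quiltP => u v /=.
have [h1 h2] := q (s u) (s v); split.
  move/(tmap_lt (@perm_inj _ s)) => h.
  have /h1 : tree_lt T (s u) (s v).
    move: h; congr tree_lt; elim/ptree_ind_mem: (tree_val T) => a ts IH /=.
    rewrite permKV -map_comp; congr PNode.
    by rewrite -[RHS]map_id; apply/eq_in_map => t /IH.
  apply: contra => h'; rewrite -(subseq_map_inj _ _ (@perm_inj _ s^-1%g)) /=.
  by rewrite !permK.
move=> ne h; rewrite -[u](permK s) -[v](permK s); apply: tmap_left.
apply: h2; first by rewrite (inj_eq perm_inj).
rewrite -(subseq_map_inj _ _ (@perm_inj _ s^-1%g)) /=.
by rewrite !permK.
Qed.

Lemma quilt_one_closed : op_one F2Surj_Brace \in supported (@is_quilt 0).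
Proof.
apply: supportedU => _; apply/is_quiltP => u v.
have -> : u = v by rewrite [u]ord1 [v]ord1.
by split=> [/tree_ltP []|]; rewrite eqxx.
Qed.

Lemma quilt_comp_closed m n (i : 'I_m.+1) (x : F2Surj_Brace m)
    (y : F2Surj_Brace n) :
  x \in supported (@is_quilt m) -> y \in supported (@is_quilt n) ->
  op_comp F2Surj_Brace i x y \in supported (@is_quilt (m + n)).
Proof.
move=> hx hy; apply: (supported_linext hx) => -[W T] /is_quiltP /= q.
apply: (supported_linext hy) => -[W' T'] /is_quiltP /= q'.
apply: (@supported_tens _ _ (word_ext i W W') (tree_ext i T T')).
- by apply: supported_sum_basis => X; rewrite mem_filter => /andP [].
- rewrite /tree_comp (eq_bigr (fun U => 1 *: << U >>)) => [|U _].
    exact: supported_sum_basis.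
  by rewrite scale1r.
move=> X U XE UE; apply/is_quiltP => u v /=.
have [e|ne] := eqVneq (beta i u) (beta i v).
  have [->|ne] := eqVneq u v.
    by split=> [/tree_ltP []|//]; rewrite eqxx.
  have /andP [/blockP [u' eu] /blockP [v' ev]] := beta_inj e ne; subst u v.
  have [h1 h2] := q' u' v'; split.
    move/(tree_ext_lt_inV UE)/h1; apply: contra => h.
    apply: (word_ext_subseq_in (s := [:: v'; u']) XE) => //=.
    by rewrite andbT eq_sym; move: ne; apply: contraNneq => ->.
  move=> ne' h; apply: (tree_ext_left_in UE); apply: h2.
    by move: ne; apply: contraNneq => ->.
  apply: (word_ext_subseq_in (s := [:: u'; v'; u']) XE) => //=.
  by rewrite andbT (eq_sym v') andbb; move: ne; apply: contraNneq => ->.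
have [h1 h2] := q (beta i u) (beta i v); split.
  move/(tree_ext_lt_out UE ne)/h1; apply: contra => h.
  apply: (word_ext_subseq_out (s := [:: v; u]) XE) => //=.
  by rewrite andbT eq_sym.
move=> _ h; apply: (tree_ext_left_out UE); first by rewrite eq_sym.
apply: h2 => //; apply: (word_ext_subseq_out (s := [:: u; v; u]) XE) => //=.
by rewrite andbT (eq_sym (beta i v)) andbb.
Qed.

Record quilt_mod n := QuiltMod {
  quilt_val : F2Surj_Brace n;
  quilt_valP : quilt_val \in supported (@is_quilt n)
}.
HB.instance Definition _ n := [isSub for @quilt_val n].
HB.instance Definition _ n := [Choice of quilt_mod n by <:].
HB.instance Definition _ n := [SubChoice_isSubZmodule of quilt_mod n by <:].

Definition Quilt : dg_operad_data := {|
  op_mod n := quilt_mod n;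
  op_homog n k := fun x => op_homog F2Surj_Brace k (quilt_val x);
  op_d n x := QuiltMod (quilt_d_closed (quilt_valP x));
  op_act n x s := QuiltMod (quilt_act_closed s (quilt_valP x));
  op_one := QuiltMod quilt_one_closed;
  op_comp m n i x y :=
    QuiltMod (quilt_comp_closed i (quilt_valP x) (quilt_valP y))
|}.

Definition quilt_to_brace n (x : Quilt n) : Brace n :=
  linext (fun b : pair_basis n =>
    if size b.1 == n.+1 then << b.2 >> else 0) (quilt_val x).

(* Main.v *)
Require Import Defs.
From HB Require Import structures.
From mathcomp Require Import all_boot all_fingroup all_algebra.
From mathcomp Require Import finmap monalg zify.

(* Quilt(n) splits as a direct sum over trees T of complexes of words.  Let z *)
(* be the last vertex of T in planar preorder.  It has no descendants and     *)
(* nothing on its right, so no letter encloses z, and z may be appended to    *)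
(* any word of the complex that does not already end in z.  Up to sign,       *)
(* W |-> W z is then a homotopy from the identity to the projection that      *)
(* keeps only the words in which z occurs once, and moves that z to the end.  *)
(* Removing z, one is left with the same complex for the preorder without z,  *)
(* and by induction with Z in degree 0, generated by the preorder word.       *)

(** The projection is the identity on trees tensored with the augmentation [word_aug], which is 1 on
    words of minimal length and 0 on longer ones. This reduces the morphism property to two facts
    about words. A composite has minimal length only if both factors do, and two words without
    repetitions have exactly one composite, with sign +1 ([fword_comp_aug]). The augmentation kills
    boundaries: only a word that is one letter too long could contribute, and the two deletions of
    its doubled letter have opposite signs ([bdry_aug]).

    The differential leaves the tree alone, so cohomology is computed one tree at a time. For a
    fixed tree the quilt condition says that the word is [compatible] with the two tree relations
    ([quilt_compatible]), and the induction on the last letter z uses only the properties of the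
    preorder recorded in [preorder_of]. Its core is [homotopy_id]: appending z contracts the complex
    onto words ending in their only z. Deleting that z is a chain map ([lin_strip_bdry]), and
    [words_acyclic] concludes that a cycle of augmentation 0 is a boundary.

    Assembling the trees, a cocycle in the kernel of the projection is a coboundary ([quilt_exact]).
    Pairing each tree with its preorder word lifts every element of [Brace] to a cocycle
    ([quilt_surjective]). *)

Set Implicit Arguments.
Unset Strict Implicit.
Unset Printing Implicit Defensive.

Import GRing.Theory.
Local Open Scope ring_scope.

(* << b >> as a constant that can be made opaque: conversion tests otherwise  *)
(* unfold the operations of the free module, which takes minutes.             *)
Definition basis (B : choiceType) (b : B) : {malg int[B]} := << b >>.

Local Notation "<< b >>" := (basis b) : ring_scope.

Lemma basisMz (B : choiceType) (b : B) (c : int) : << b >> *~ c = << c *g b >>.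
Proof. by rewrite /basis -raddfMz /= intz. Qed.

(** * Linear maps out of free abelian groups *)

Section Lin.
Variables (B : choiceType) (V : zmodType).
Implicit Types (f g : B -> V) (x y : {malg int[B]}).

(** Unlike [linext], this has values in any abelian group, so that augmentations to the integers and
    coefficient maps are covered too. *)
Definition lin f x : V := \sum_(b <- msupp x) f b *~ x@_b.

Lemma linEw f x (d : {fset B}) :
  (msupp x `<=` d)%fset -> lin f x = \sum_(b <- d) f b *~ x@_b.
Proof.
move=> le; rewrite /lin (big_fset_incl _ le) // => b _ /mcoeff_outdom ->.
by rewrite mulr0z.
Qed.

Fact lin_is_zmod_morphism f : zmod_morphism (lin f).
Proof.
move=> x y; rewrite !(@linEw f _ (msupp x `|` msupp y)%fset).
- by rewrite -sumrB; apply: eq_bigr => b _; rewrite mcoeffB mulrzBr.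
- exact: fsubsetUr.
- exact: fsubsetUl.
- exact: msuppB_le.
Qed.
HB.instance Definition _ f :=
  GRing.isZmodMorphism.Build {malg int[B]} V (lin f) (lin_is_zmod_morphism f).

Lemma lin0 f : lin f 0 = 0. Proof. exact: raddf0. Qed.
Lemma linN f x : lin f (- x) = - lin f x. Proof. exact: raddfN. Qed.
Lemma linD f x y : lin f (x + y) = lin f x + lin f y. Proof. exact: raddfD. Qed.
Lemma linB f x y : lin f (x - y) = lin f x - lin f y. Proof. exact: raddfB. Qed.
Lemma linMz f x c : lin f (x *~ c) = lin f x *~ c. Proof. exact: raddfMz. Qed.
Lemma lin_sum f (I : Type) (r : seq I) (F : I -> {malg int[B]}) :
  lin f (\sum_(i <- r) F i) = \sum_(i <- r) lin f (F i).
Proof. exact: raddf_sum. Qed.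

Lemma linU f b : lin f << b >> = f b.
Proof. by rewrite /lin /basis msuppU oner_eq0 big_seq_fset1 mcoeffUU. Qed.

Lemma linZ f c x : lin f (c *: x) = lin f x *~ c.
Proof. by rewrite -[c in LHS]intz scaler_int raddfMz. Qed.

Lemma eq_lin f g x : (forall b, x@_b != 0 -> f b = g b) -> lin f x = lin g x.
Proof.
move=> h; rewrite /lin big_seq [RHS]big_seq; apply: eq_bigr => b.
by rewrite -mcoeff_neq0 => /h ->.
Qed.

Lemma lin0f x : lin (fun=> 0) x = 0.
Proof. by rewrite /lin big1 // => b _; rewrite mul0rz. Qed.

Lemma linD_fun f g x : lin (fun b => f b + g b) x = lin f x + lin g x.
Proof. by rewrite /lin -big_split; apply: eq_bigr => b _; rewrite /= mulrzDl. Qed.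

Lemma linN_fun f x : lin (fun b => - f b) x = - lin f x.
Proof. by rewrite /lin -sumrN; apply: eq_bigr => b _; rewrite mulNrz. Qed.

End Lin.

Lemma lin_sum_fun (B : choiceType) (V : zmodType) (I : finType)
    (F : I -> B -> V) x :
  lin (fun b => \sum_i F i b) x = \sum_i lin (F i) x.
Proof.
rewrite /lin exchange_big; apply: eq_bigr => b _.
by rewrite mulrz_suml.
Qed.

Lemma lin_mulrz (B : choiceType) (V : zmodType) (v : V) (f : B -> int) x :
  lin (fun b => v *~ f b) x = v *~ lin f x.
Proof.
rewrite /lin mulrz_sumr; apply: eq_bigr => b _.
by rewrite -mulrzA -[f b *~ _]mulrzr intz.
Qed.

Lemma raddf_lin (B : choiceType) (V V' : zmodType) (g : {additive V -> V'})
    (f : B -> V) x : g (lin f x) = lin (g \o f) x.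
Proof. by rewrite raddf_sum; apply: eq_bigr => b _; rewrite raddfMz. Qed.

Lemma lin_lin (B C : choiceType) (V : zmodType) (f : B -> {malg int[C]})
    (g : C -> V) x : lin g (lin f x) = lin (fun b => lin g (f b)) x.
Proof. exact: raddf_lin. Qed.

Lemma linextE (B C : choiceType) (f : B -> {malg int[C]}) : linext f =1 lin f.
Proof.
move=> x; apply: eq_bigr => b _.
by rewrite -{1}[x@_b]intz scaler_int.
Qed.

Lemma lin_id (B : choiceType) (x : {malg int[B]}) : lin (fun b => << b >>) x = x.
Proof.
rewrite {2}[x]monalgE; apply: eq_bigr => b _.
exact: basisMz.
Qed.

Definition supp_in (B : choiceType) (P : B -> Prop) (x : {malg int[B]}) :=
  forall b, x@_b != 0 -> P b.

Section SuppIn.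
Variables (B : choiceType) (P : B -> Prop).
Implicit Types x y : {malg int[B]}.

Lemma supp_in0 : supp_in P 0.
Proof. by move=> b; rewrite mcoeff0 eqxx. Qed.

Lemma supp_inD x y : supp_in P x -> supp_in P y -> supp_in P (x + y).
Proof.
move=> hx hy b; rewrite mcoeffD; have [->|/hx //] := eqVneq x@_b 0.
by rewrite add0r => /hy.
Qed.

Lemma supp_inMz x c : (c != 0 -> supp_in P x) -> supp_in P (x *~ c).
Proof.
have [->|nc hx] := eqVneq c 0; first by move=> _; rewrite mulr0z; apply: supp_in0.
move=> b; rewrite raddfMz /= -mulrzr => nz; apply: hx => //.
by apply: contraNneq nz => ->; rewrite mul0r.
Qed.

Lemma supp_inN x : supp_in P x -> supp_in P (- x).
Proof. by move=> hx b; rewrite mcoeffN oppr_eq0 => /hx. Qed.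

Lemma supp_inU b : P b -> supp_in P << b >>.
Proof.
move=> Pb b'; rewrite /basis mcoeffU.
by have [<-|] := eqVneq b b'; rewrite ?eqxx.
Qed.

Lemma supp_in_sum (I : Type) (r : seq I) (F : I -> {malg int[B]}) :
  (forall i, supp_in P (F i)) -> supp_in P (\sum_(i <- r) F i).
Proof.
move=> h; elim: r => [|i r IH]; first by rewrite big_nil; apply: supp_in0.
by rewrite big_cons; apply: supp_inD.
Qed.

End SuppIn.

Lemma supp_in_lin (B C : choiceType) (P : B -> Prop) (Q : C -> Prop)
    (f : B -> {malg int[C]}) x :
  supp_in P x -> (forall b, P b -> supp_in Q (f b)) -> supp_in Q (lin f x).
Proof. by move=> hx hf; apply: supp_in_sum => b; apply: supp_inMz => /hx /hf. Qed.

Lemma supp_inW (B : choiceType) (P Q : B -> Prop) (x : {malg int[B]}) :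
  (forall b, P b -> Q b) -> supp_in P x -> supp_in Q x.
Proof. by move=> PQ hx b /hx /PQ. Qed.

Local Opaque lin basis.

(** * The complex of all words and the homotopy that appends z *)

Section Words.
Variable A : choiceType.
Implicit Types (U V W L : seq A) (a u v z : A).

Local Notation pre a := (lin (fun W => << a :: W >>)).
Local Notation post z := (lin (fun W => << rcons W z >>)).

(* The differential of words, by recursion on the first letter a: if a occurs *)
(* again it is the first caesura, and all other signs change except when the  *)
(* deleted letter is the second and last occurrence of a, with sign (-1)^2.   *)
Fixpoint bdry W : {malg int[seq A]} :=
  if W is a :: V then
    (if a \in V then - << V >> - pre a (bdry V) else pre a (bdry V)) +
    (if count_mem a V == 1%N then << a :: rem a V >> else 0)
  else 0.

Lemma bdry_cons a V : bdry (a :: V) =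
  (if a \in V then - << V >> - pre a (bdry V) else pre a (bdry V)) +
  (if count_mem a V == 1%N then << a :: rem a V >> else 0).
Proof. by []. Qed.

Lemma count1_mem a V : count_mem a V == 1%N -> a \in V.
Proof. by rewrite -has_pred1 has_count => /eqP ->. Qed.

(** Only repeated letters are deleted, so no letter disappears. *)
Lemma bdry_mem W : supp_in (fun U => U =i W) (bdry W).
Proof.
elim: W => [|a V IH]; first exact: supp_in0.
have memV : a \in V -> V =i a :: V.
  by move=> aV u; rewrite inE; case: eqP => [->|].
have pIH : supp_in (fun U => U =i a :: V) (pre a (bdry V)).
  by apply: supp_in_lin IH _ => U e; apply: supp_inU => u; rewrite !inE e.
rewrite bdry_cons; apply: supp_inD.
  case: ifP => // aV; apply: supp_inD; apply: supp_inN => //.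
  by apply: supp_inU; apply: memV.
case: ifP => [/count1_mem aV|_]; last exact: supp_in0.
apply: supp_inU => u; rewrite -(memV aV).
by rewrite (perm_mem (perm_to_rem aV)).
Qed.

Lemma bdry_uniq W : uniq W -> bdry W = 0.
Proof.
elim: W => // a V IH /andP [aV /IH e]; rewrite bdry_cons (negbTE aV) e.
by rewrite lin0 add0r (count_memPn aV).
Qed.

Lemma count_rcons a V z : count_mem a (rcons V z) = (count_mem a V + (z == a))%N.
Proof. by rewrite -cats1 count_cat /= addn0. Qed.

Lemma rem_rcons a V z : a \in V -> rem a (rcons V z) = rcons (rem a V) z.
Proof.
elim: V => //= b V IH; rewrite inE eq_sym.
by case: eqP => //= _ /IH ->.
Qed.

Lemma bdry_rcons V z : z \notin V -> bdry (rcons V z) = post z (bdry V).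
Proof.
elim: V => [|a V IH] /=; first by rewrite !lin0 addr0.
rewrite inE negb_or => /andP [za zV].
rewrite mem_rcons inE eq_sym (negbTE za) /= count_rcons (negbTE za) addn0 IH //.
have pp x : pre a (post z x) = post z (pre a x).
  by rewrite !lin_lin; apply: eq_lin => U _; rewrite !linU.
rewrite linD /= pp; congr (_ + _).
  by case: (a \in V) => //; rewrite linB linN linU.
by case: ifP => [/count1_mem aV|_]; rewrite ?lin0 // linU rem_rcons.
Qed.

Definition strip z W : {malg int[seq A]} :=
  if count_mem z W == 1%N then << rem z W >> else 0.

Lemma mem_remN a b V : a != b -> (a \in rem b V) = (a \in V).
Proof.
move=> ne; elim: V => //= c V IH; case: eqP => [->|_].
  by rewrite inE (negbTE ne).
by rewrite !inE IH.
Qed.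

Lemma count_remN a b V : a != b -> count_mem a (rem b V) = count_mem a V.
Proof.
move=> ne; elim: V => //= c V IH; case: eqP => [->|_] /=; last by rewrite IH.
by rewrite eq_sym (negbTE ne).
Qed.

Lemma rem_comm a b V : rem a (rem b V) = rem b (rem a V).
Proof.
elim: V => //= c V IH; case: (eqVneq c b) => [eb|nb]; case: (eqVneq c a) => [ea|na] /=.
- by rewrite -ea -eb.
- by rewrite eb eqxx.
- by rewrite ea eqxx.
- by rewrite (negbTE nb) (negbTE na) IH.
Qed.

Lemma strip_consN z a V : a != z -> strip z (a :: V) = pre a (strip z V).
Proof.
move=> ne; rewrite /strip /= (negbTE ne) add0n.
by case: ifP => _; rewrite ?lin0 // linU.
Qed.

Lemma strip_cons z V : z \notin V -> strip z (z :: V) = << V >>.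
Proof. by rewrite /strip /= eqxx => /count_memPn ->. Qed.

Lemma strip_cons2 z V : z \in V -> strip z (z :: V) = 0.
Proof.
by rewrite /strip /= eqxx -has_pred1 has_count; case: (count_mem z V).
Qed.

(** If z occurs once, it is neither deleted nor a caesura, so removing it changes no sign. If z
    occurs twice, its two deletions have opposite signs and strip to the same word. If it occurs
    more often, every term still contains z twice. *)
Lemma lin_strip_bdry z W : lin (strip z) (bdry W) = lin bdry (strip z W).
Proof.
elim: W => [|a V IH]; first by rewrite /strip /= !lin0.
have [->|ne] := eqVneq a z; last first.
  have ne' : z != a by rewrite eq_sym.
  rewrite (strip_consN _ ne) lin_lin.
  have sp x : lin (strip z) (pre a x) = pre a (lin (strip z) x).
    by rewrite !lin_lin; apply: eq_lin => U _; rewrite linU strip_consN.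
  rewrite bdry_cons linD /=.
  have -> : lin (strip z) (if a \in V then - << V >> - pre a (bdry V) else pre a (bdry V))
      = if a \in V then - strip z V - pre a (lin bdry (strip z V))
        else pre a (lin bdry (strip z V)).
    by case: ifP => _; rewrite ?linB ?linN /= ?linU sp IH.
  have -> : strip z V = if count_mem z V == 1%N then << rem z V >> else 0 by [].
  case: (eqVneq (count_mem z V) 1%N) => [e|n1]; last first.
    rewrite !lin0 ?subr0 ?oppr0 ?addr0 if_same ?add0r.
    case: ifP => [_|_]; last by rewrite !lin0.
    rewrite linU (strip_consN _ ne) /strip.
    by rewrite (count_remN _ ne') (negbTE n1) lin0.
  rewrite !linU bdry_cons (mem_remN _ ne) (count_remN _ ne); congr (_ + _).
  case: ifP => [_|_]; last by rewrite !lin0.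
    rewrite linU (strip_consN _ ne) /strip.
  by rewrite (count_remN _ ne') e eqxx linU rem_comm.
rewrite bdry_cons; case: ifP => [zV|/negbT zV].
  rewrite (strip_cons2 zV) lin0 linD linB linN /= linU.
  have -> : lin (strip z) (pre z (bdry V)) = 0.
    rewrite lin_lin -[RHS](lin0f _ (bdry V)); apply: eq_lin => U nz.
    by rewrite linU strip_cons2 ?(bdry_mem nz).
  rewrite subr0 {1}/strip; case: ifP => [/eqP e|_]; last by rewrite !lin0 ?addr0 ?oppr0.
  rewrite linU strip_cons ?addNr //.
  by apply/count_memPn; rewrite count_rem e zV /= eqxx.
rewrite (strip_cons zV) linU.
rewrite (count_memPn zV).
rewrite addr0 lin_lin -[RHS]lin_id; apply: eq_lin => U nz.
by rewrite linU strip_cons ?(bdry_mem nz).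
Qed.

(* The sign of the homotopy W |-> +- W z, which is 0 if W ends in z: the      *)
(* parity of the number of caesuras of W before its last z.                   *)
Fixpoint hsign z W : int :=
  if W is a :: V then
    if z \in V then (if a \in V then - hsign z V else hsign z V)
    else ((a == z) && (V != [::]))%:Z
  else 0.

Definition homotopy z W : {malg int[seq A]} := << rcons W z >> *~ hsign z W.

Lemma hsign_rcons z V : hsign z (rcons V z) = 0.
Proof.
elim: V => [|a V IH] /=; first by rewrite eqxx.
by rewrite mem_rcons mem_head IH oppr0 if_same.
Qed.

Lemma homotopy_cons z a V : z \in V -> homotopy z (a :: V) =
  if a \in V then - pre a (homotopy z V) else pre a (homotopy z V).
Proof.
move=> zV; rewrite /homotopy /= zV linMz /= linU.
by case: ifP => _; rewrite ?mulrNz.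
Qed.

(** The only [a] of [V] is not a caesura and stands before every z, so removing it neither changes
    the caesuras before the last z nor brings that z to the end. *)
Lemma hsign_rem z a V : a != z -> z \in V -> count_mem a V = 1%N ->
  ~~ subseq [:: z; a] V -> hsign z (rem a V) = hsign z V.
Proof.
elim: V => // b V IH ne /=; rewrite inE; case: (eqVneq b a) => [->|nb].
  rewrite eq_sym (negbTE ne) /= => zV; rewrite add1n zV => -[] /count_memPn aV _.
  by rewrite (negbTE aV).
rewrite add0n eq_sym; case: (eqVneq b z) => [bz|nz] /=.
  by rewrite bz sub1seq -has_pred1 has_count => _ ->.
move=> zV e sub; rewrite mem_remN 1?eq_sym // zV mem_remN // IH //.
Qed.

(** The sign is chosen so that deleting the appended z gives back [W] with coefficient 1. Deleting
    the former last z gives the projection term if z occurs once in [W], and otherwise cancels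
    against the homotopy applied to [W] without its last z. A deletion before the last z flips
    [hsign], and one after it gains a sign because the last z becomes a caesura in W z. Since no
    letter encloses z, these cases do not mix. *)
Lemma homotopy_id z W : z \in W -> sorted (fun u v => u != v) W ->
  (forall u, u != z -> ~~ subseq [:: u; z; u] W) ->
  lin bdry (homotopy z W) + lin (homotopy z) (bdry W) =
  << W >> - post z (strip z W).
Proof.
elim: W => // a V IH aW srt sub.
have srtV : sorted (fun u v => u != v) V by apply: path_sorted srt.
have subV u : u != z -> ~~ subseq [:: u; z; u] V.
  by move=> /sub; apply: contra => h; apply: subseq_trans h (subseq_cons _ _).
have pp x : pre a (post z x) = post z (pre a x).
  by rewrite !lin_lin; apply: eq_lin => U _; rewrite !linU.
have [zV|zV] := boolP (z \in V); last first.
  have -> : a = z by move: aW; rewrite inE (negbTE zV) orbF eq_sym => /eqP.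
  rewrite (strip_cons zV) linU /homotopy /= (negbTE zV) eqxx (count_memPn zV) addr0.
  case: V {IH aW srt sub srtV subV} zV => [|b V] zV.
    by rewrite mulr0z !lin0 addr0 subrr.
  set V' := b :: V in zV *.
  rewrite mulr1z linU (bdry_cons z (rcons V' z)) mem_rcons mem_head bdry_rcons //.
  have -> : rem z (rcons V' z) = V'.
    elim: (V') zV => [|c U IH] /=; first by rewrite eqxx.
    by rewrite inE negb_or eq_sym => /andP [/negbTE -> /IH ->].
  have -> : (count_mem z (rcons V' z) == 1%N).
    by rewrite count_rcons (count_memPn zV) eqxx.
  have -> : lin (fun W => << rcons W z >> *~ hsign z W) (pre z (bdry V')) =
      pre z (post z (bdry V')).
    rewrite !lin_lin; apply: eq_lin => U /bdry_mem e; rewrite !linU /=.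
    rewrite e (negbTE zV) eqxx /=; case: U e => // /(_ b).
    by rewrite mem_head.
  by rewrite addrAC addrC -addrA addNr addr0 addrC.
have memU : supp_in (fun U => z \in U /\ (a \in U) = (a \in V)) (bdry V).
  by move=> U /bdry_mem e; rewrite !e.
have hp : lin (homotopy z) (pre a (bdry V)) =
    if a \in V then - pre a (lin (homotopy z) (bdry V))
    else pre a (lin (homotopy z) (bdry V)).
  rewrite !lin_lin.
  transitivity (lin (fun U => if a \in V then - pre a (homotopy z U)
                              else pre a (homotopy z U)) (bdry V)).
    by apply: eq_lin => U /memU [zU aU]; rewrite linU homotopy_cons // aU.
  by case: ifP => _ //; rewrite linN_fun.
have bp : lin bdry (pre a (homotopy z V)) = bdry (a :: rcons V z) *~ hsign z V.
  by rewrite /homotopy !linMz /= !linU.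
have bh : lin bdry (homotopy z V) = bdry (rcons V z) *~ hsign z V.
  by rewrite linMz /= linU.
have pbh : pre a (bdry (rcons V z)) *~ hsign z V = pre a (lin bdry (homotopy z V)).
  by rewrite bh linMz.
have pIH : pre a (lin bdry (homotopy z V)) + pre a (lin (homotopy z) (bdry V)) =
    << a :: V >> - pre a (post z (strip z V)).
  by rewrite -linD IH // linB /= linU.
(* Here [h] will be [homotopy z V], coming from the deletion of the first letter, which enters the
   two halves with opposite signs. In [alg2], [r] plays the same role for the deletion of the second
   of exactly two occurrences of [a]. *)
have alg (G : zmodType) (h p q r : G) : p + h + (- h + q + r) = p + q + r.
  by rewrite -!addrA addNKr.
have alg2 (G : zmodType) (h p q r : G) : p + h - r + (- h + q + r) = p + q.
  by rewrite addrACA addNr addr0 -!addrA addNKr.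
have [az|ne] := eqVneq a z.
  subst a; rewrite (strip_cons2 zV) lin0 subr0 (homotopy_cons _ zV) zV linN /= bp.
  rewrite !bdry_cons zV mem_rcons mem_head count_rcons eqxx.
  have -> : (count_mem z V + true == 1)%N = false.
    by rewrite addn1 eqSS -leqn0 leqNgt -has_count has_pred1 zV.
  rewrite zV in hp; rewrite addr0 mulrzBl mulNrz opprB opprK pbh.
  rewrite linD linB linN /= linU hp opprK -/(homotopy z V).
  have -> : lin (homotopy z) (if count_mem z V == 1%N then << z :: rem z V >> else 0)
      = pre z (post z (strip z V)).
    rewrite /strip; case: ifP => [/eqP e|_]; last by rewrite !lin0.
    rewrite !linU /homotopy /= eqxx.
    have -> /= : z \in rem z V = false.
      by apply/negbTE/count_memPn; rewrite count_rem e zV /= eqxx.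
    case E: (rem z V) => [|c U]; last by rewrite mulr1z.
    (* Otherwise the whole word would be z z, which has an adjacent repetition. *)
    have : perm_eq V [:: z] by rewrite -E perm_to_rem.
    move=> /perm_size.
    case: V zV srt {IH sub srtV subV bp bh pbh pIH memU hp e E aW} => // b [] //.
    by rewrite inE => /eqP <-; rewrite /= eqxx.
  by rewrite alg pIH subrK.
rewrite (strip_consN _ ne) -pp (homotopy_cons _ zV) bdry_cons.
case: ifP hp => [aV|/negbT aV] hp.
  have subaV : ~~ subseq [:: z; a] V by move: (sub a ne); rewrite /= eqxx.
  rewrite linN /= bp bdry_cons mem_rcons inE (negbTE ne) aV /= count_rcons.
  rewrite [z == a]eq_sym (negbTE ne) addn0 (rem_rcons _ aV) linD linB linN /= linU hp.
  rewrite mulrzDl mulrzBl mulNrz pbh -/(homotopy z V) opprK.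
  have -> : lin (homotopy z) (if count_mem a V == 1%N then << a :: rem a V >> else 0)
     = (if count_mem a V == 1%N then << a :: rcons (rem a V) z >> else 0) *~ hsign z V.
    case: ifP => [/eqP e|_]; last by rewrite lin0 mul0rz.
    have aR : a \in rem a V = false.
      by apply/negbTE/count_memPn; rewrite count_rem e aV /= eqxx.
    have zR : z \in rem a V by rewrite mem_remN // eq_sym.
    by rewrite linU /homotopy /= aR zR (hsign_rem ne zV e subaV).
  by rewrite opprD opprB opprK alg2 pIH.
rewrite bp bdry_cons mem_rcons inE (negbTE ne) (negbTE aV) /= count_rcons.
rewrite [z == a]eq_sym (negbTE ne) (count_memPn aV) !addr0 pbh hp.
exact: pIH.
Qed.

End Words.

Arguments bdry {A}.

(** * Acyclicity of the words compatible with a preorder *)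

Section Compatible.
Variable A : choiceType.
Implicit Types (U V W L : seq A) (a u v z : A).

Local Notation post z := (lin (fun W => << rcons W z >>)).

Record compatible (lt left : rel A) L W : Prop := Compatible {
  compatible_mem : W =i L;
  compatible_sorted : sorted (fun u v => u != v) W;
  compatible_cross : forall u v, u != v -> ~~ subseq [:: u; v; u; v] W;
  compatible_lt : forall u v, lt u v -> ~~ subseq [:: v; u] W;
  compatible_nest : forall u v, u != v -> subseq [:: u; v; u] W -> left v u
}.

Definition preorder_of (lt left : rel A) L : Prop :=
  irreflexive lt /\ forall u v, subseq [:: u; v] L ->
    [/\ ~~ lt v u, ~~ left v u & lt u v || left u v].

Lemma subseq_rcons_notin s u W z :
  u != z -> subseq (rcons s u) (rcons W z) = subseq (rcons s u) W.
Proof.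
move=> ne; rewrite -subseq_rev -(subseq_rev (rcons s u) W) !rev_rcons /=.
by rewrite (negbTE ne).
Qed.

Lemma subseq_rcons2 s W z : subseq (rcons s z) (rcons W z) = subseq s W.
Proof. by rewrite -subseq_rev !rev_rcons /= eqxx subseq_rev. Qed.

(** Deleting z makes its two neighbours adjacent; they differ because u z u is excluded. *)
Lemma sorted_rem z W : sorted (fun u v => u != v) W ->
  (forall u, u != z -> ~~ subseq [:: u; z; u] W) ->
  sorted (fun u v => u != v) (rem z W).
Proof.
elim: W => // a V IH srt sub /=; have srtV := path_sorted srt.
case: (eqVneq a z) => // az.
have subV u : u != z -> ~~ subseq [:: u; z; u] V.
  by move=> /sub; apply: contra => h; apply: subseq_trans h (subseq_cons _ _).
move: (IH srtV subV) srt (sub _ az); case: V {IH sub subV srtV} => //= b V.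
case: (eqVneq b z) => /= [->|_] + /andP [ab _] s; last by rewrite ab.
case: V s => //= c V; rewrite !eqxx /= => s ->; rewrite andbT.
by apply: contra s => /eqP ->; rewrite eqxx sub0seq.
Qed.

Section LastLetter.
Variables (lt left : rel A) (L : seq A) (z : A).
Hypotheses (uL : uniq (rcons L z)) (pL : preorder_of lt left (rcons L z)).

Lemma last_notin : z \notin L.
Proof. by move: uL; rewrite rcons_uniq => /andP []. Qed.

Lemma last_preorder u : u \in rcons L z -> u != z ->
  [/\ ~~ lt z u, ~~ left z u & lt u z || left u z].
Proof.
rewrite mem_rcons inE => /predU1P [->|uL' _]; first by rewrite eqxx.
by apply: pL.2; rewrite -cats1 -(cat1s u) cat_subseq // sub1seq // inE.
Qed.

Lemma preorder_of_belast : preorder_of lt left L.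
Proof.
split=> [|u v h]; first exact: pL.1.
by apply: pL.2; apply: subseq_trans h (subseq_rcons _ _).
Qed.

(** A letter enclosing z would have z on its left, but z comes last in the preorder and is to the
    left of nothing. *)
Lemma compatible_last_nest W u : compatible lt left (rcons L z) W ->
  u != z -> ~~ subseq [:: u; z; u] W.
Proof.
move=> cW ne; apply/negP => s.
have uW : u \in rcons L z by rewrite -(compatible_mem cW) (mem_subseq s) // mem_head.
case: (last_preorder uW ne) => _ /negP + _; apply.
by apply: (compatible_nest cW ne s).
Qed.

(** The nonzero sign guarantees that [W] does not end in z. The new nestings are z v z: as v occurs
    after a z it is not an ancestor of z, and since it precedes z in the preorder it must lie to its
    left. *)
Lemma compatible_rcons W : compatible lt left (rcons L z) W ->
  hsign z W != 0 -> compatible lt left (rcons L z) (rcons W z).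
Proof.
move=> cW nz; have [mW sW xW lW nW] := cW.
have zW : z \in W by rewrite mW mem_rcons mem_head.
split.
- by move=> u; rewrite mem_rcons inE mW mem_rcons inE orbA orbb.
- case/lastP: W {cW mW xW lW nW zW} sW nz => // W b sW nz.
  rewrite -cats1 cat_rcons sorted_cat_cons sW /= andbT.
  by apply: contraNneq nz => ->; rewrite hsign_rcons.
- move=> u v ne; have [ev|nv] := eqVneq v z; last first.
    by rewrite (@subseq_rcons_notin [:: u; v; u]) ?xW.
  subst v; rewrite (@subseq_rcons2 [:: u; z; u]).
  exact: compatible_last_nest.
- move=> u v luv; have [eu|nu] := eqVneq u z; last first.
    by rewrite (@subseq_rcons_notin [:: v]) ?lW.
  subst u; rewrite (@subseq_rcons2 [:: v]) sub1seq; apply/negP => vW.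
  have [ev|nv] := eqVneq v z.
    by move: luv; rewrite ev pL.1.
  have /(last_preorder)/(_ nv) [] : v \in rcons L z by rewrite -mW.
  by rewrite luv.
- move=> u v ne; have [eu|nu] := eqVneq u z; last first.
    by rewrite (@subseq_rcons_notin [:: u; v]) //; apply: nW.
  subst u; rewrite (@subseq_rcons2 [:: z; v]) => s.
  have vW : v \in rcons L z by rewrite -mW (mem_subseq s) // !inE eqxx orbT.
  rewrite eq_sym in ne; have [_ _ /orP [/lW|//]] := last_preorder vW ne.
  by rewrite s.
Qed.

Lemma compatible_rem W : compatible lt left (rcons L z) W ->
  count_mem z W == 1%N -> compatible lt left L (rem z W).
Proof.
move=> cW c1; have zW := count1_mem c1.
have sub s : subseq s (rem z W) -> subseq s W.
  by move=> h; apply: subseq_trans h (rem_subseq _ _).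
split.
- move=> u; have [->|ne] := eqVneq u z.
    rewrite (negbTE last_notin); apply/negbTE/count_memPn.
    by rewrite count_rem (eqP c1) zW /= eqxx.
  by rewrite mem_remN // (compatible_mem cW) mem_rcons inE (negbTE ne).
- apply: sorted_rem (compatible_sorted cW) _.
  by move=> u; apply: compatible_last_nest.
- by move=> u v /(compatible_cross cW); apply: contra => /sub.
- by move=> u v /(compatible_lt cW); apply: contra => /sub.
- by move=> u v ne /sub; apply: (compatible_nest cW).
Qed.

Lemma compatible_append V : compatible lt left L V ->
  compatible lt left (rcons L z) (rcons V z).
Proof.
case=> mV sV xV lV nV.
have zV u s : subseq s V -> u \in s -> u != z.
  move=> /mem_subseq sV' us; move: (sV' u us); rewrite mV; apply: contraTneq => ->.
  exact: last_notin.
split.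
- by move=> u; rewrite !mem_rcons !inE mV.
- case/lastP: V sV {mV xV lV nV} zV => // V b sV zV.
  rewrite -cats1 cat_rcons sorted_cat_cons sV /= andbT.
  by apply: (zV _ [:: b]); rewrite ?sub1seq ?mem_rcons mem_head.
- move=> u v ne; have [ev|nv] := eqVneq v z; last first.
    by rewrite (@subseq_rcons_notin [:: u; v; u]) ?xV.
  subst v; rewrite (@subseq_rcons2 [:: u; z; u]); apply/negP => s.
  by have := zV z _ s; rewrite !inE eqxx ?orbT => /(_ isT).
- move=> u v luv; have [eu|nu] := eqVneq u z; last first.
    by rewrite (@subseq_rcons_notin [:: v]) ?lV.
  subst u; rewrite (@subseq_rcons2 [:: v]) sub1seq mV; apply/negP => vL.
  have vL' : v \in rcons L z by rewrite mem_rcons inE vL orbT.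
  have nv : v != z by apply: contraTneq vL => ->; exact: last_notin.
  by have [] := last_preorder vL' nv; rewrite luv.
- move=> u v ne; have [eu|nu] := eqVneq u z; last first.
    by rewrite (@subseq_rcons_notin [:: u; v]) //; apply: nV.
  subst u; rewrite (@subseq_rcons2 [:: z; v]) => s.
  by have := zV z _ s; rewrite !inE eqxx ?orbT => /(_ isT).
Qed.

End LastLetter.

Definition word_aug n W : int := (size W == n)%:Z.

Lemma words_acyclic lt left L (k : int) (x : {malg int[seq A]}) :
  uniq L -> preorder_of lt left L ->
  supp_in (fun W => compatible lt left L W /\ (size W)%:Z = k) x ->
  lin bdry x = 0 -> lin (word_aug (size L)) x = 0 ->
  exists2 y, supp_in (fun W => compatible lt left L W /\ (size W)%:Z = k + 1) y
    & x = lin bdry y.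
Proof.
elim/last_ind: L k x => [|L z IH] k x uL pL sx dx ax.
  exists 0; first exact: supp_in0.
  have nil W : x@_W != 0 -> W = [::].
    case: W => // a W /sx [[/(_ a)]].
    by rewrite mem_head.
  suff -> : x = 0 by rewrite lin0.
  apply/malgP => W; rewrite mcoeff0; apply/eqP/negPn/negP => nz; case/negP: (nz).
  (* With no letters, the augmentation is the coefficient of the empty word. *)
  rewrite (nil _ nz); rewrite -[x in x@_ _]lin_id raddf_lin -ax.
  by apply/eqP/eq_lin => V _ /=; rewrite mcoeffU /word_aug; case: V.
have uL' : uniq L by move: uL; rewrite rcons_uniq => /andP [].
have zL := last_notin uL.
have pL' := preorder_of_belast pL.
have sx' : supp_in (fun W => compatible lt left L W /\ (size W)%:Z = k - 1)
    (lin (strip z) x).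
  apply: supp_in_lin sx _ => W [cW szW]; rewrite /strip.
  case: ifP => [c1|_]; last exact: supp_in0.
  apply: supp_inU; split; first exact: compatible_rem c1.
  have zW := count1_mem c1; rewrite size_rem //.
  have : (0 < size W)%N by case: (W) zW.
  by rewrite -szW; case: (size W) => // n _; rewrite -[in RHS]addn1 PoszD addrK.
have dx' : lin bdry (lin (strip z) x) = 0.
  transitivity (lin (strip z) (lin bdry x)); last by rewrite dx lin0.
  by rewrite !lin_lin; apply: eq_lin => W _; rewrite lin_strip_bdry.
have ax' : lin (word_aug (size L)) (lin (strip z) x) = 0.
  rewrite -[RHS]ax lin_lin; apply: eq_lin => W /sx [cW _].
  rewrite /strip /word_aug size_rcons; case: ifP => [c1|nc1].
    rewrite linU size_rem ?count1_mem //; have := count1_mem c1.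
    by case: (W).
  (* A compatible word of minimal length has no repetition, hence contains z once; so stripping
     loses nothing that the augmentation sees. *)
  rewrite lin0; case: eqP => // e; move: nc1.
  have uW : uniq W.
    apply: (@leq_size_uniq _ (rcons L z)) => //; last by rewrite e size_rcons.
    by move=> u; rewrite (compatible_mem cW).
  by rewrite count_uniq_mem // (compatible_mem cW) mem_rcons mem_head.
have [y' sy' ey'] := IH _ _ uL' pL' sx' dx' ax'.
(* As x is a cycle, the homotopy formula writes it as the boundary of [homotopy z x] plus its
   stripped part followed by z, and that part is the boundary of [y']. *)
exists (lin (homotopy z) x + post z y').
  apply: supp_inD.
    apply: supp_in_lin sx _ => W [cW szW]; apply: supp_inMz => nz.
    apply: supp_inU; split; first exact: compatible_rcons.
    by rewrite size_rcons -szW -addn1 PoszD.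
  apply: supp_in_lin sy' _ => V [cV szV]; apply: supp_inU; split.
    exact: compatible_append.
  by rewrite size_rcons -addn1 PoszD szV subrK.
have hid : lin bdry (lin (homotopy z) x) + lin (homotopy z) (lin bdry x) =
    x - post z (lin (strip z) x).
  transitivity (lin (fun W => << W >> - post z (strip z W)) x); last first.
    by rewrite linD_fun linN_fun lin_id lin_lin.
  rewrite !lin_lin -[LHS]linD_fun; apply: eq_lin => W /sx [cW _].
  apply: homotopy_id.
  - by rewrite (compatible_mem cW) mem_rcons mem_head.
  - exact: compatible_sorted cW.
  - by move=> u; apply: compatible_last_nest cW.
have bp : lin bdry (post z y') = post z (lin bdry y').
  rewrite !lin_lin; apply: eq_lin => V /sy' [cV _]; rewrite linU bdry_rcons //.
  by rewrite (compatible_mem cV).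
by rewrite linD /= bp -ey'; move: hid; rewrite dx lin0 addr0 => ->; rewrite subrK.
Qed.

End Compatible.

(** * The recursive differential as a signed sum over positions *)

Lemma card_ord_recl n (P : pred 'I_n.+1) :
  #|[set q | P q]| = (P ord0 + #|[set q : 'I_n | P (lift ord0 q)]|)%N.
Proof.
rewrite -!sum1dep_card [LHS]big_mkcond big_ord_recl -big_mkcond.
by case: (P ord0).
Qed.

Section Signs.
Variable A : choiceType.
Implicit Types (V W : seq A) (a c : A).

Local Notation letter W := (tnth (in_tuple W)).
Local Notation pre a := (lin (fun W => << a :: W >>)).

Lemma letter_lift a V (p : 'I_(size V)) :
  letter (a :: V) (lift ord0 p) = letter V p.
Proof. by rewrite !(tnth_nth a). Qed.

Lemma caesura_lift a V (p : 'I_(size V)) :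
  caesura (lift ord0 p : 'I_(size (a :: V))) = caesura p.
Proof. by rewrite /caesura letter_lift. Qed.

Lemma caesura_ord0 a V : caesura (ord0 : 'I_(size (a :: V))) = (a \in V).
Proof. by rewrite /caesura /= drop0. Qed.

Lemma mem_take_letter V c (p : nat) :
  (exists2 r : 'I_(size V), (r < p)%N & letter V r = c) <-> c \in take p V.
Proof.
split=> [[r rp <-]|h].
  rewrite (tnth_nth (letter V r)) -(nth_take _ rp) mem_nth // size_take_min.
  by rewrite leq_min rp ltn_ord.
have lt : (index c V < size V)%N by rewrite index_mem (mem_take h).
exists (Ordinal lt); last by rewrite (tnth_nth c) nth_index // (mem_take h).
rewrite /= -[in index _ V](cat_take_drop p V) index_cat h.
by apply: leq_trans (geq_minl p (size V)); rewrite -size_take_min index_mem.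
Qed.

Lemma count_letter V (p : 'I_(size V)) : count_mem (letter V p) V =
  (count_mem (letter V p) (take p V) + (count_mem (letter V p) (drop p.+1 V)).+1)%N.
Proof.
set u := letter V p; rewrite -[V in LHS](cat_take_drop p) count_cat.
by rewrite (drop_nth u) //= -[nth u V p](tnth_nth u (in_tuple V)) eqxx.
Qed.

Lemma sgn_del_ord0 a V : a \in V -> sgn_del (ord0 : 'I_(size (a :: V))) = -1.
Proof.
move=> aV; rewrite /sgn_del caesura_ord0 aV.
rewrite card_ord_recl caesura_ord0 aV /= -sum1dep_card big1 ?addn0 //.
by move=> q; rewrite /= andbF.
Qed.

(** If [a] occurs in [V], its new occurrence is a first caesura, counted for p as soon as p is a
    caesura or its letter occurs earlier in [a :: V]. *)
Lemma sgn_del_lift a V (p : 'I_(size V)) :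
  sgn_del (lift ord0 p : 'I_(size (a :: V))) =
  (-1) ^+ ((a \in V) && (caesura p || (letter V p \in a :: take p V))) * sgn_del p.
Proof.
rewrite /sgn_del caesura_lift letter_lift; case: ifP => cp.
  rewrite card_ord_recl caesura_ord0 /= !andbT exprD; congr (_ * _ ^+ _).
  by apply: eq_card => q; rewrite !inE caesura_lift.
rewrite card_ord_recl caesura_ord0 -addnS exprD.
congr (_ ^+ nat_of_bool (_ && _) * _ ^+ _.+1).
  rewrite inE orFb; apply/existsP/idP.
    case; case=> [[|r] lr] /and3P [_ rp /eqP <-]; first by rewrite (tnth_nth a) eqxx.
    apply/orP; right; apply: (proj1 (mem_take_letter _ _ _)).
    exists (Ordinal (lr : r < size V)%N) => //.
    by rewrite !(tnth_nth a).
  case/predU1P => [e|/(proj2 (mem_take_letter _ _ _)) [r rp e]].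
    by exists ord0; rewrite /= (tnth_nth a) e.
  by exists (lift ord0 r); rewrite letter_lift e eqxx andbT.
apply: eq_card => q; rewrite !inE caesura_lift; congr (_ && _).
apply/existsP/existsP => -[].
  case=> [[|r] lr] /and3P [//= qr rp e]; exists (Ordinal (lr : r < size V)%N).
  by move: e; rewrite !(tnth_nth a) /= => ->; rewrite andbT; apply/andP.
by move=> r h; exists (lift ord0 r); rewrite letter_lift.
Qed.

Lemma bdry_sum W : bdry W = \sum_(p < size W)
  if (1 < count_mem (letter W p) W)%N then << delete p W >> *~ sgn_del p else 0.
Proof.
elim: W => [|a V IH]; first by rewrite big_ord0.
rewrite big_ord_recl bdry_cons /delete /= eqxx add1n ltnS -has_count has_pred1 drop0.
have -> : (if a \in V then - << V >> - pre a (bdry V) else pre a (bdry V)) =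
    (if a \in V then << V >> *~ sgn_del (ord0 : 'I_(size (a :: V))) else 0) +
    pre a (bdry V) *~ (-1) ^+ (a \in V).
  by case: ifP => aV; rewrite ?sgn_del_ord0 ?mulrN1z ?add0r.
rewrite -addrA; congr (_ + _); rewrite IH lin_sum mulrz_suml.
have -> : (if count_mem a V == 1%N then << a :: rem a V >> else 0) =
    \sum_(p < size V) if (letter V p == a) && (count_mem a V == 1%N)
      then << a :: delete p V >> else 0 :> {malg int[seq A]}.
  case: ifP => [c1|_]; last by rewrite big1 // => p _; rewrite andbF.
  have aV := count1_mem c1; have lt : (index a V < size V)%N by rewrite index_mem.
  rewrite (bigD1 (Ordinal lt)) //= big1 => [|p ne].
    by rewrite (tnth_nth a) nth_index // eqxx addr0 /delete /= remE.
  case: eqP => // e; case/eqP: ne; apply: val_inj => /=.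
  have /eqP := count_letter p; rewrite e (eqP c1) addnS eqSS eq_sym addn_eq0.
  case/andP => /eqP/count_memPn nt _.
  rewrite -[in RHS](cat_take_drop p V) index_cat (negbTE nt) (drop_nth a) //.
  rewrite -[nth a V p](tnth_nth a (in_tuple V)) e /= eqxx addn0 size_takel //.
  exact: ltnW.
rewrite -big_split; apply: eq_bigr => p _ /=.
rewrite sgn_del_lift letter_lift -/(delete p V).
have [lt1|le1] := ltnP 1 (count_mem (letter V p) V).
  rewrite (leq_trans lt1 (leq_addl _ _)).
  have -> : (letter V p == a) && (count_mem a V == 1%N) = false.
    by apply/negbTE; rewrite negb_and -implybE; apply/implyP => /eqP <-; rewrite gtn_eqF.
  have -> : caesura p || (letter V p \in a :: take p V).
    rewrite /caesura inE orbCA -!has_pred1 !has_count; apply/orP; right.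
    by move: lt1; rewrite count_letter addnS ltnS addn_gt0 orbC.
  by rewrite andbT addr0 linMz /= linU -mulrzA mulrC.
have c1 : count_mem (letter V p) V = 1%N.
  by apply/eqP; rewrite eqn_leq le1 count_letter addnS.
rewrite lin0 mul0rz add0r c1 addn1 ltnS lt0b eq_sym.
case: eqP => [e|//]; rewrite e c1 /=.
have /eqP := count_letter p; rewrite c1 addnS eqSS eq_sym addn_eq0.
case/andP => /eqP/count_memPn nt /eqP/count_memPn nd.
(* For an unrepeated letter [sgn_del] counts no caesura and takes the default value -1; prepending
   [a] flips it to the +1 of the extra term in [bdry_cons]. *)
rewrite inE eqxx orbT andbT -has_pred1 has_count c1 /sgn_del /caesura (negbTE nd).
rewrite (_ : [set _ | _] = set0) ?cards0 ?mulrNN ?mulr1 ?mulr1z //.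
apply/setP => q; rewrite !inE; apply/negbTE; rewrite negb_and; apply/orP; right.
apply/existsP => -[r /and3P [_ rp /eqP er]]; case/negP: nt.
by apply/mem_take_letter; exists r.
Qed.

End Signs.

(** * Words without repetitions and their compositions *)

Section UniqWords.
Variable A : eqType.
Implicit Types (W X Y : seq A).

Lemma uniq_sorted_neq W : uniq W -> sorted (fun u v => u != v) W.
Proof. by rewrite uniq_pairwise => /pairwise_sorted. Qed.

Lemma destutter_id W : sorted (fun u v => u != v) W -> destutter W = W.
Proof.
elim: W => // a [|b W] IH // /andP [ab srt].
rewrite destutter_cons IH //= ifN //.
by apply: contra ab => /eqP [->].
Qed.

Lemma destutter_nseq W X k a :
  destutter (W ++ nseq k.+1 a ++ X) = destutter (W ++ a :: X).
Proof.
elim: W => [|b W IH]; last by rewrite !cat_cons !destutter_cons IH; case: W {IH}.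
by elim: k => // k IH; rewrite -IH [LHS]/= eqxx.
Qed.

Lemma eq_uniq_order X Y : uniq X -> uniq Y -> X =i Y ->
  (forall u v, subseq [:: u; v] X -> ~~ subseq [:: v; u] Y) -> X = Y.
Proof.
elim: X Y => [|a X IH] [|b Y] //=.
- by move=> _ _ /(_ b); rewrite mem_head.
- by move=> _ _ /(_ a); rewrite mem_head.
move=> /andP [aX uX] /andP [bY uY] e ord.
have eab : a = b.
  apply/eqP; apply: contraT => ne.
  have bX : b \in X by move: (e b); rewrite !inE eqxx eq_sym (negbTE ne).
  have aY : a \in Y by move: (e a); rewrite !inE eqxx (negbTE ne).
  by have := ord a b; rewrite /= !eqxx !sub1seq bX aY => /(_ isT).
subst b; congr (_ :: _); apply: IH => // [u|u v s].
  have := e u; rewrite !inE; case: eqP => [->|//] _.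
  by rewrite (negbTE aX) (negbTE bY).
have := ord u v (subseq_trans s (subseq_cons _ _)); apply: contra => s'.
exact: subseq_trans s' (subseq_cons _ _).
Qed.

Lemma uniq_interposed W a : uniq W -> interposed W a = false.
Proof.
move=> uW; apply/negbTE/existsP => -[p /existsP [q /and3P [/eqP pq _ h]]].
set b := tnth _ p in h.
suff : subseq [:: b; b] W by move/subseq_uniq/(_ uW); rewrite /= inE eqxx.
have bp : b \in take q.+1 W.
  have lt : (p < q.+1)%N by rewrite pq leqW.
  rewrite [b in b \in _](tnth_nth b) -(nth_take b lt) mem_nth // size_takel //.
have := @cat_subseq _ [:: b] [:: b] (take q.+1 W) (drop q.+1 W).
by rewrite !sub1seq cat_take_drop; apply.
Qed.

End UniqWords.

Section Fwords.
Variable n : nat.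
Implicit Types W : fword n.

Lemma size_fword W : (n <= size W)%N.
Proof.
rewrite -{1}(size_enum_ord n); apply: uniq_leq_size; first exact: enum_uniq.
by move=> u _; apply: mem_fword.
Qed.

Lemma fword_uniq W : uniq W = (size W == n).
Proof.
apply/idP/eqP => [uW|sW].
  apply/eqP; rewrite eqn_leq size_fword andbT.
  rewrite -[X in (_ <= X)%N](size_enum_ord n).
  by apply: uniq_leq_size => // u _; rewrite mem_enum.
apply: (@leq_size_uniq _ (enum 'I_n)); first exact: enum_uniq.
  by move=> u _; apply: mem_fword.
by rewrite sW size_enum_ord.
Qed.

Lemma uniq_is_fword (W : seq 'I_n) : uniq W -> (forall u, u \in W) -> is_fword W.
Proof.
move=> uW mW; apply/is_fwordP; split=> // [|u v _]; first exact: uniq_sorted_neq.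
by apply: contraL uW => /subseq_uniq h; apply/negP => /h; rewrite /= !inE eqxx orbT.
Qed.

End Fwords.

Section PermutationComp.
Variables (m n : nat) (i : 'I_m.+1) (W : fword m.+1) (W' : fword n.+1).
Hypotheses (uW : uniq W) (uW' : uniq W').

(** This is [gamma] away from [i]: the inverse of [beta] outside the block. *)
Let out (a : 'I_m.+1) : 'I_(m + n).+1 :=
  inord (if (a < i)%N then a : nat else (a + n)%N).

Lemma out_val a : out a = (if (a < i)%N then a : nat else (a + n)%N) :> nat.
Proof.
rewrite /out inordK //; have := ltn_ord a.
by case: ifP => _; lia.
Qed.

Lemma beta_out a : a != i -> beta i (out a) = a.
Proof.
rewrite -val_eqE /= => ne; apply: val_inj; rewrite /= betaE out_val.
case: (ltnP a i) => h; first by rewrite h.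
rewrite ltnNge (leq_trans h (leq_addr _ _)) /=; case: leqP => h'; last by rewrite addnK.
by move: ne h h'; lia.
Qed.

Lemma block_out a : a != i -> block i (out a) = false.
Proof.
rewrite -val_eqE /= /block out_val => ne.
by case: ltnP => h; apply/negbTE; lia.
Qed.

Lemma out_beta c : ~~ block i c -> beta i c != i /\ out (beta i c) = c.
Proof.
rewrite /block => nb; split.
  rewrite -val_eqE /= betaE; move: nb.
  by case: (ltnP c i) => h; case: (leqP c (i + n)) => h' /=; lia.
apply: val_inj; rewrite /= out_val betaE.
case: (ltnP c i) => h; first by rewrite h.
case: (leqP c (i + n)) => h'; first by rewrite h h' in nb.
by move: h h'; case: (ltnP (c - n) i) => h2; lia.
Qed.

Lemma beta_alpha a : beta i (@alpha m n i a) = i.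
Proof.
apply: val_inj; rewrite /= betaE alphaE ltnNge leq_addr /= leq_add2l.
by rewrite -ltnS ltn_ord.
Qed.

Let W1 := take (index i W) W.
Let W2 := drop (index i W).+1 W.

Let WE : W = W1 ++ i :: W2 :> seq _.
Proof.
rewrite -[LHS](cat_take_drop (index i W)) (drop_nth i) ?index_mem ?mem_fword //.
by rewrite nth_index // mem_fword.
Qed.

Let iW12 a : a \in W1 ++ W2 -> a != i.
Proof.
move: uW; rewrite WE -cat1s uniq_catCA /= => /andP [h _].
by apply: contraTneq => ->.
Qed.

Let X0 := map out W1 ++ map (alpha i) W' ++ map out W2.

Lemma perm_comp_fword : is_fword X0.
Proof.
have mX0 u : u \in X0.
  rewrite !mem_cat; case: (boolP (block i u)) => [/blockP [a ->]|].
    by rewrite map_f ?orbT // mem_fword.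
  case/out_beta => ne eu; have := mem_fword W (beta i u).
  rewrite WE mem_cat inE (negbTE ne) /= => /orP [] h.
    by rewrite -{1}eu map_f.
  by rewrite -{3}eu map_f // !orbT.
apply: uniq_is_fword => //; apply: (@leq_size_uniq _ (enum 'I_(m + n).+1)).
- exact: enum_uniq.
- by move=> u _.
rewrite size_enum_ord !size_cat !size_map.
move: uW uW'; rewrite !fword_uniq {1}WE size_cat /= => /eqP e /eqP ->.
by move: e; lia.
Qed.

Lemma perm_comp_ext : word_ext i W W' (FWord perm_comp_fword).
Proof.
have fout (s : seq _) : {subset s <= W1 ++ W2} -> filter (block i) (map out s) = [::].
  elim: s => //= a s IH sub; rewrite block_out; last by apply/iW12/sub/mem_head.
  by apply: IH => b bs; apply: sub; rewrite inE bs orbT.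
have bout (s : seq _) : {subset s <= W1 ++ W2} -> map (@beta m n i) (map out s) = s.
  move=> sub; rewrite -map_comp -[RHS]map_id; apply/eq_in_map => a /sub /iW12.
  exact: beta_out.
have s1 : {subset W1 <= W1 ++ W2} by move=> a h; rewrite mem_cat h.
have s2 : {subset W2 <= W1 ++ W2} by move=> a h; rewrite mem_cat h orbT.
apply/and3P; split=> /=.
- have -> : size W = (size W1 + (size W2).+1)%N by rewrite {1}WE size_cat.
  by rewrite !size_cat !size_map; lia.
- rewrite !filter_cat !fout // cats0 /= (all_filterP _); last first.
    by apply/allP => _ /mapP [a _ ->]; apply/blockP; exists a.
  rewrite destutter_id // uniq_sorted_neq // map_inj_uniq //.
  exact: alpha_inj.
rewrite !map_cat !bout // -map_comp (eq_map (g := fun=> i)); last first.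
  by move=> a /=; rewrite beta_alpha.
have -> : map (fun=> i) W' = nseq (size W').-1.+1 i.
  case: (fword_val W') (mem_fword W' ord0) => // a s _ /=; congr (_ :: _).
  by elim: s => //= b s ->.
by rewrite destutter_nseq -WE destutter_id // uniq_sorted_neq.
Qed.

(** By its length [X] has no repetition, and the order of two of its letters is dictated by [W'] if
    both lie in the block and by [W] otherwise. *)
Lemma word_ext_unique X : word_ext i W W' X -> X = FWord perm_comp_fword.
Proof.
move=> XE; have YE := perm_comp_ext; apply: val_inj => /=.
set Y := FWord _ in YE *; rewrite -[RHS]/(fword_val Y); move: Y YE => Y YE.
have uniqE Z : word_ext i W W' Z -> uniq Z.
  case/and3P => /eqP e _ _; rewrite fword_uniq; apply/eqP.
  by move: uW uW' e; rewrite !fword_uniq => /eqP -> /eqP ->; lia.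
apply: eq_uniq_order; rewrite ?uniqE //; first by move=> u; rewrite !mem_fword.
move=> u v sX; apply/negP => sY.
have ne : u != v.
  apply: contraTneq (uniqE _ XE) => e; apply/negP => /(subseq_uniq sX).
  by rewrite e /= inE eqxx.
have [e|nb] := eqVneq (beta i u) (beta i v).
  have /andP [/blockP [u' eu] /blockP [v' ev]] := beta_inj e ne; subst u v.
  have ne' : u' != v' by apply: contraNneq ne => ->.
  apply: (uniq_subseq2 uW' (u := u') (v := v')).
    by apply: (word_ext_subseq_in XE) => //=; rewrite ne'.
  by apply: (word_ext_subseq_in YE) => //=; rewrite eq_sym ne'.
apply: (uniq_subseq2 uW (u := beta i u) (v := beta i v)).
  by apply: (word_ext_subseq_out XE (s := [:: u; v])) => //=; rewrite nb.
by apply: (word_ext_subseq_out YE (s := [:: v; u])) => //=; rewrite eq_sym nb.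
Qed.

End PermutationComp.

Lemma mem_word_exts m n (i : 'I_m.+1) (W : fword m.+1) (W' : fword n.+1) X :
  (X \in word_exts i W W') = word_ext i W W' X.
Proof.
rewrite mem_filter andb_idr // => /and3P [/eqP e _ _].
rewrite mem_pmap_sub; have szX : size X == (size W + size W').-1 by rewrite -e.
by apply/imageP; exists (Tuple szX).
Qed.

Lemma word_exts_uniq m n (i : 'I_m.+1) (W : fword m.+1) (W' : fword n.+1) :
  uniq (word_exts i W W').
Proof.
apply/filter_uniq/pmap_sub_uniq; rewrite map_inj_uniq ?enum_uniq //.
exact: val_inj.
Qed.

Lemma fword_comp_aug m n (i : 'I_m.+1) (W : fword m.+1) (W' : fword n.+1) :
  lin (fun X : fword (m + n).+1 => word_aug (m + n).+1 X) (fword_comp i W W') =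
  ((size W == m.+1) && (size W' == n.+1))%:Z.
Proof.
rewrite lin_sum; under eq_bigr do rewrite linZ [lin _ _]linU.
have [/andP [sW sW']|ns] := boolP (_ && _); last first.
  (* Lengths add up to one more than that of [X], and no factor is shorter than its arity, so a
     minimal [X] forces both factors to be minimal. *)
  rewrite big_seq big1 // => X; rewrite mem_word_exts => /andP [/eqP e _].
  rewrite /word_aug; case: eqP => [eX|_]; last by rewrite mul0rz.
  case/negP: ns; have := size_fword W; have := size_fword W'.
  by move: e; rewrite eX; lia.
have uW : uniq W by rewrite fword_uniq.
have uW' : uniq W' by rewrite fword_uniq.
rewrite (perm_big [:: FWord (perm_comp_fword i uW uW')]) /=.
  rewrite big_seq1 /word_aug.
  have /and3P [/eqP e _ _] := perm_comp_ext i uW uW'.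
  have -> : shuffle_inv i W W' (FWord (perm_comp_fword i uW uW')) = 0%N.
    apply/eqP; rewrite cards_eq0; apply/eqP/setP => ab; rewrite !inE.
    by rewrite uniq_interposed.
  rewrite expr0 mulr1z; suff -> : size (FWord (perm_comp_fword i uW uW')) = (m + n).+1.
    by rewrite eqxx.
  by move: e; rewrite (eqP sW) (eqP sW'); lia.
apply: uniq_perm; rewrite ?word_exts_uniq // => X.
rewrite mem_word_exts inE; apply/idP/eqP => [/(word_ext_unique uW uW') //|->].
exact: perm_comp_ext.
Qed.

(** * Tensors, and the passage from [fword] to plain sequences *)

Lemma tensE (B C : choiceType) (x : {malg int[B]}) (y : {malg int[C]}) :
  tens x y = lin (fun b => lin (fun c => << (b, c) >>) y) x.
Proof.
rewrite /tens; apply: eq_bigr => b _; rewrite mulrz_suml; apply: eq_bigr => c _.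
by rewrite -mulrzA mulrC basisMz.
Qed.

Lemma lin_tens (B C : choiceType) (V : zmodType) (f : B * C -> V) x y :
  lin f (tens x y) = lin (fun b => lin (fun c => f (b, c)) y) x.
Proof.
rewrite tensE lin_lin; apply: eq_lin => b _.
by rewrite lin_lin; apply: eq_lin => c _; rewrite linU.
Qed.

Lemma tensU (B C : choiceType) (x : {malg int[B]}) (c : C) :
  tens x << c >> = lin (fun b => << (b, c) >>) x.
Proof. by rewrite tensE; apply: eq_lin => b _; rewrite linU. Qed.

Lemma supp_supported (B : choiceType) (P : pred B) x :
  supp_in (fun b => P b) x <-> x \in supported P.
Proof. by split=> [h|/supportedP //]; apply/supportedP. Qed.

Lemma sum_eq_if (V : zmodType) (I : finType) (i : I) (v : I -> V) :
  \sum_j (if i == j then v j else 0) = v i.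
Proof.
rewrite (bigD1 i) //= eqxx big1 ?addr0 // => j.
by rewrite eq_sym => /negbTE ->.
Qed.

Section FwordBoundary.
Variable n : nat.

Definition fword_chain (x : {malg int[fword n]}) : {malg int[seq 'I_n]} :=
  lin (fun W : fword n => << fword_val W >>) x.

Definition seq_fword (W : seq 'I_n) : {malg int[fword n]} :=
  if insub W is Some V then << V >> else 0.

Lemma fword_chainK x : lin seq_fword (fword_chain x) = x.
Proof.
rewrite lin_lin -[RHS]lin_id; apply: eq_lin => W _.
by rewrite linU /seq_fword valK.
Qed.

Lemma seq_fwordK (x : {malg int[seq 'I_n]}) :
  supp_in (@is_fword n) x -> fword_chain (lin seq_fword x) = x.
Proof.
move=> sx; rewrite /fword_chain lin_lin -[RHS]lin_id; apply: eq_lin => W /sx fW.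
by rewrite /seq_fword insubT linU.
Qed.

Lemma fword_chain_d (W : fword n) : fword_chain (fword_d W) = bdry W.
Proof.
rewrite bdry_sum /fword_chain lin_sum; apply: eq_bigr => p _.
rewrite linZ /fword_del; case: insubP => [V|].
  by rewrite delete_fword => -> <-; rewrite linU.
by rewrite delete_fword => /negbTE ->; rewrite lin0 mul0rz.
Qed.

Lemma fword_chain_lin_d x :
  fword_chain (lin (@fword_d n) x) = lin bdry (fword_chain x).
Proof.
rewrite /fword_chain !lin_lin; apply: eq_lin => W _.
by rewrite linU; apply: fword_chain_d.
Qed.

End FwordBoundary.

Lemma bdry_aug (A : choiceType) (W : seq A) :
  lin (word_aug (size (undup W))) (bdry W) = 0.
Proof.
elim: W => [|a V IH]; first by rewrite lin0.
have undup_le (U : seq A) : U =i V -> (size (undup V) <= size U)%N.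
  by move=> e; apply: uniq_leq_size (undup_uniq V) _ => u; rewrite mem_undup e.
have pre_aug k : lin (word_aug k.+1) (lin (fun U => << a :: U >>) (bdry V)) =
    lin (word_aug k) (bdry V).
  by rewrite lin_lin; apply: eq_lin => U _; rewrite linU.
rewrite bdry_cons linD /=; case: (boolP (a \in V)) => aV; last first.
  by rewrite (count_memPn aV) lin0 addr0 pre_aug IH.
rewrite linB linN linU lin_lin.
(* Each [U] already contains all letters of [V], including [a], so [a :: U] is too long to be seen
   by the augmentation. *)
have -> : lin (fun U => lin (word_aug (size (undup V))) << a :: U >>) (bdry V) = 0.
  rewrite -[RHS](lin0f _ (bdry V)); apply: eq_lin => U /bdry_mem /undup_le le.
  by rewrite linU /word_aug gtn_eqF.
rewrite subr0; case: (eqVneq (count_mem a V) 1%N) => [e|ne].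
  by rewrite linU /word_aug /= size_rem // prednK ?addNr //; case: (V) aV.
rewrite lin0 addr0 /word_aug; case: eqP => [e|_]; last by rewrite oppr0.
case/negP: ne; have uV : uniq V by rewrite -[uniq V]negbK -ltn_size_undup -e ltnn.
by rewrite count_uniq_mem ?aV.
Qed.

(** * Quilts over a fixed tree *)

Section Trees.
Variable n : nat.
Implicit Types T : tree n.

Lemma tree_preorder T : preorder_of (tree_lt T) (tree_left T) (labels T).
Proof.
split=> [u|u v s]; first by rewrite /tree_lt eqxx.
have uT := tree_uniq T.
have nlt : ~~ tree_lt T v u.
  by apply/negP => /tree_lt_subseq; apply: uniq_subseq2 uT s.
have nleft : ~~ tree_left T v u.
  by apply/negP => /tree_left_subseq; apply: uniq_subseq2 uT s.
split=> //; case: (tree_total (mem_tree T u) (mem_tree T v)).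
- by move=> e; subst v; case: (uniq_subseq2 uT s s).
- by move=> ->.
- by rewrite (negbTE nlt).
- by rewrite (negbTE nleft) => -[->|//]; rewrite orbT.
Qed.

Lemma size_labels T : size (labels T) = n.
Proof. by rewrite (perm_size (tree_valP T)) size_enum_ord. Qed.

End Trees.

Lemma quilt_compatible n (W : fword n.+1) (T : tree n.+1) :
  is_quilt ((W, T) : pair_basis n) <->
  compatible (tree_lt T) (tree_left T) (labels T) W.
Proof.
split=> [/is_quiltP q|cW].
  have [mW sW xW] := is_fwordP _ (fword_valP W).
  split=> // [u|u v|u v ne]; first by rewrite mW mem_tree.
    by case: (q u v).
  by case: (q u v) => _; apply.
apply/is_quiltP => u v; split; first exact: (compatible_lt cW).
exact: (compatible_nest cW).
Qed.

Lemma compatible_fword n (W : seq 'I_n.+1) (T : tree n.+1) :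
  compatible (tree_lt T) (tree_left T) (labels T) W -> is_fword W.
Proof.
by case=> mW sW xW _ _; apply/is_fwordP; split=> // u; rewrite mW mem_tree.
Qed.

Lemma quilt_words_acyclic n (T : tree n.+1) (k : int) (x : {malg int[fword n.+1]}) :
  supp_in (fun W => is_quilt ((W, T) : pair_basis n) /\ fword_deg W = k) x ->
  lin (@fword_d n.+1) x = 0 ->
  lin (fun W : fword n.+1 => word_aug n.+1 W) x = 0 ->
  exists2 y, supp_in (fun W => is_quilt ((W, T) : pair_basis n) /\
                               fword_deg W = k - 1) y
    & lin (@fword_d n.+1) y = x.
Proof.
move=> sx dx ax.
(* Degree k means length n + 1 - k, so one more letter lowers the degree by one. *)
have [|||y sy ey] := @words_acyclic _ _ _ (labels T) (n.+1%:Z - k)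
  (fword_chain x) (tree_uniq T) (tree_preorder T).
- apply: supp_in_lin sx _ => W [/quilt_compatible cW dW]; apply: supp_inU.
  by split=> //; rewrite -dW /fword_deg opprB addrC subrK.
- by rewrite -fword_chain_lin_d dx /fword_chain lin0.
- rewrite lin_lin size_labels -[RHS]ax; apply: eq_lin => W _.
  by rewrite linU.
exists (lin (@seq_fword n.+1) y).
  apply: supp_in_lin sy _ => W [cW dW]; have fW := compatible_fword cW.
  rewrite /seq_fword insubT; apply: supp_inU; split.
    by apply/quilt_compatible.
  by rewrite /fword_deg /= dW; lia.
rewrite -[LHS]fword_chainK fword_chain_lin_d seq_fwordK; last first.
  by move=> W /sy [/compatible_fword].
by rewrite -ey fword_chainK.
Qed.

(** * The projection is a morphism *)

Definition quilt_proj n (b : pair_basis n) : {malg int[tree n.+1]} :=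
  if size b.1 == n.+1 then << b.2 >> else 0.

Lemma quilt_to_braceE n (x : Quilt n) :
  quilt_to_brace x = lin (@quilt_proj n) (quilt_val x).
Proof. exact: linextE. Qed.

(** This is the factorization of the projection as augmentation tensor identity, used for both the
    differential and composition. *)
Lemma lin_quilt_proj_tens n (x : {malg int[fword n.+1]}) (y : {malg int[tree n.+1]}) :
  lin (@quilt_proj n) (tens x y) =
  y *~ lin (fun W : fword n.+1 => word_aug n.+1 W) x.
Proof.
rewrite lin_tens.
transitivity (lin (fun W : fword n.+1 => y *~ word_aug n.+1 W) x).
  apply: eq_lin => W _; rewrite /quilt_proj /word_aug /=.
  by case: eqP => _; rewrite ?lin0f ?lin_id.
exact: lin_mulrz.
Qed.

Lemma fword_d_aug n (W : fword n) :
  lin (fun V : fword n => word_aug n V) (fword_d W) = 0.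
Proof.
have <- : lin (word_aug n) (fword_chain (fword_d W)) =
    lin (fun V : fword n => word_aug n V) (fword_d W).
  by rewrite lin_lin; apply: eq_lin => V _; rewrite linU.
have eW : size (undup W) = n.
  apply/eqP; rewrite -[X in _ == X]size_enum_ord; apply/eqP.
  by apply/perm_size/uniq_perm; rewrite ?undup_uniq ?enum_uniq // => u;
    rewrite mem_undup mem_enum mem_fword.
by rewrite fword_chain_d -[X in word_aug X]eW bdry_aug.
Qed.

Lemma quilt_val_is_quilt n (x : Quilt n) b : (quilt_val x)@_b != 0 -> is_quilt b.
Proof. by move: b; apply/supp_supported/quilt_valP. Qed.

Lemma Quilt_dE n (x : Quilt n) : quilt_val (op_d Quilt x) =
  lin (fun b : pair_basis n => tens (fword_d b.1) << b.2 >>) (quilt_val x).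
Proof. exact: linextE. Qed.

Lemma quilt_to_brace_morphism : dg_operad_morphism Quilt Brace quilt_to_brace.
Proof.
split=> [n x y|n k x hx|n x|n x s||m n i x y].
- by rewrite !quilt_to_braceE /= linD.
- have [->//|nk] := eqVneq k 0; apply/orP; right; apply/eqP.
  rewrite quilt_to_braceE -[RHS](lin0f _ (quilt_val x)); apply: eq_lin => b.
  have /supp_supported sx := hx; move=> /sx /eqP e; rewrite /quilt_proj.
  case: eqP => // eb; move: nk; rewrite -e /fword_deg eb subrr eqxx //.
- rewrite quilt_to_braceE Quilt_dE lin_lin -[RHS](lin0f _ (quilt_val x)).
  by apply: eq_lin => b _; rewrite [LHS]lin_quilt_proj_tens fword_d_aug mulr0z.
- rewrite !quilt_to_braceE /= !linextE !lin_lin; apply: eq_lin => -[W T] _.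
  rewrite [LHS]linU /quilt_proj /= size_map; case: eqP => _; last by rewrite lin0.
  by rewrite linU.
- by rewrite quilt_to_braceE [LHS]linU.
rewrite !quilt_to_braceE /= !linextE !lin_lin; apply: eq_lin => -[W T] _.
rewrite linextE lin_lin.
transitivity (lin (fun c : pair_basis n => tree_comp i T c.2 *~
    ((size W == m.+1) && (size c.1 == n.+1))%:Z) (quilt_val y)).
  apply: eq_lin => c _; rewrite [LHS]lin_quilt_proj_tens; congr (_ *~ _).
  exact: fword_comp_aug.
rewrite {2}/quilt_proj /=; case: eqP => _; last by rewrite lin0 lin0f.
rewrite linU linextE lin_lin; apply: eq_lin => -[W' T'] _; rewrite /quilt_proj /=.
by case: eqP => _; rewrite ?mulr1z ?mulr0z ?linU ?lin0.
Qed.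

(** * The projection on cohomology *)

Definition fword_part n (T : tree n.+1) (b : pair_basis n) : {malg int[fword n.+1]} :=
  if b.2 == T then << b.1 >> else 0.

Lemma quilt_exact n (k : int) (x : Quilt n) :
  cocycle k x -> quilt_to_brace x = 0 -> coboundary k x.
Proof.
case=> hx dx px.
have {}dx :
    lin (fun b : pair_basis n => tens (fword_d b.1) << b.2 >>) (quilt_val x) = 0.
  by rewrite -Quilt_dE dx.
have sx b : (quilt_val x)@_b != 0 -> is_quilt b /\ fword_deg b.1 = k.
  move=> nz; split; first exact: quilt_val_is_quilt nz.
  by apply/eqP; move: b nz; apply/supp_supported.
have ex_y (T : tree n.+1) : exists y, supp_in (fun W : fword n.+1 =>
      is_quilt ((W, T) : pair_basis n) /\ fword_deg W = k - 1) y /\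
    lin (@fword_d n.+1) y = lin (fword_part T) (quilt_val x).
  have [|||y sy ey] := @quilt_words_acyclic n T k (lin (fword_part T) (quilt_val x)).
  - apply: supp_in_lin (sx : supp_in _ _) _ => -[W T'] [qW dW]; rewrite /fword_part /=.
    have [eT|_] := eqVneq T' T; last exact: supp_in0.
    by apply: supp_inU; rewrite -eT.
  (* Taking the part over T commutes with the differential, which fixes the tree. *)
  - transitivity (lin (fword_part T)
        (lin (fun b : pair_basis n => tens (fword_d b.1) << b.2 >>) (quilt_val x))).
      rewrite !lin_lin; apply: eq_lin => -[W T'] _; rewrite tensU lin_lin /fword_part /=.
      transitivity (lin (fun W' => if T' == T then << W' >> else 0) (fword_d W));
        last first.
        by apply: eq_lin => W' _; rewrite linU.
      by case: eqP => _; rewrite ?lin_id ?linU // lin0 lin0f.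
    by rewrite dx lin0.
  (* The augmentation of the part over T is the coefficient of T in the image of x. *)
  - transitivity ((quilt_to_brace x)@_T); last by rewrite px mcoeff0.
    rewrite lin_lin quilt_to_braceE [RHS]raddf_lin; apply: eq_lin => -[W T'] _.
    rewrite /fword_part /quilt_proj /word_aug /=.
    case: (eqVneq T' T) => [->|ne]; last first.
      by rewrite lin0; case: eqP => _; rewrite ?mcoeff0 // mcoeffU (negbTE ne).
    by rewrite linU /=; case: eqP => _; rewrite ?mcoeff0 // mcoeffUU.
  by exists y.
(* There are finitely many trees, so the primitives chosen for each of them can be summed. *)
have [f hf] := fin_all_exists ex_y.
pose y0 : {malg int[pair_basis n]} :=
  \sum_T lin (fun W => << ((W, T) : pair_basis n) >>) (f T).
have sy0 : supp_in (fun b : pair_basis n => is_quilt b /\ fword_deg b.1 = k - 1) y0.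
  apply: supp_in_sum => T; have [sf _] := hf T.
  by apply: supp_in_lin sf _ => W qW; apply: supp_inU.
have qy0 : y0 \in supported (@is_quilt n).
  by apply/supp_supported; apply: supp_inW sy0 => b [].
exists (QuiltMod qy0).
  by apply/supp_supported; apply: supp_inW sy0 => b [_ ->].
apply: val_inj; rewrite /= -[RHS]/(quilt_val (op_d Quilt (QuiltMod qy0))) Quilt_dE /=.
rewrite lin_sum -[LHS]lin_id.
transitivity (\sum_T lin (fun b : pair_basis n =>
    if b.2 == T then << ((b.1, T) : pair_basis n) >> else 0) (quilt_val x)).
  rewrite -lin_sum_fun; apply: eq_lin => -[W T] _ /=.
  by rewrite (sum_eq_if T (fun T' => << ((W, T') : pair_basis n) >>)).
apply: eq_bigr => T _; have [_ eT] := hf T.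
transitivity (lin (fun W => << ((W, T) : pair_basis n) >>) (lin (@fword_d n.+1) (f T))).
  rewrite eT lin_lin; apply: eq_lin => -[W T'] _; rewrite /fword_part /=.
  by case: eqP => _; rewrite ?lin0 ?linU.
rewrite !lin_lin; apply: eq_lin => W _; rewrite linU.
by rewrite [RHS]tensU.
Qed.

Lemma labels_is_fword n (T : tree n) : is_fword (labels T).
Proof. by apply: uniq_is_fword (tree_uniq T) _ => u; apply: mem_tree. Qed.

Lemma labels_quilt n (T : tree n.+1) :
  is_quilt ((FWord (labels_is_fword T), T) : pair_basis n).
Proof.
apply/is_quiltP => u v /=; split.
  move/tree_lt_subseq => s; apply/negP => s'.
  exact: uniq_subseq2 (tree_uniq T) s s'.
by move=> _ /subseq_uniq /(_ (tree_uniq T)); rewrite /= !inE eqxx orbT.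
Qed.

(** The lift pairs each tree with its preorder word, which is a cocycle because nothing in it is
    repeated. *)
Lemma quilt_surjective n (k : int) (y : Brace n) : op_homog Brace k y ->
  exists2 x : Quilt n, cocycle k x & quilt_to_brace x = y.
Proof.
move=> hy; pose w (T : tree n.+1) : pair_basis n := (FWord (labels_is_fword T), T).
pose x0 := lin (fun T => << w T >>) (y : {malg int[tree n.+1]}).
have qx0 : x0 \in supported (@is_quilt n).
  apply/supp_supported; apply: (@supp_in_lin _ _ (fun=> True)) => // T _.
  by apply: supp_inU; apply: labels_quilt.
exists (QuiltMod qx0); [split|].
- case/orP: hy => [/eqP ->|/eqP y0]; last by rewrite /= /x0 y0 lin0 rpred0.
  apply/supp_supported; apply: (@supp_in_lin _ _ (fun=> True)) => // T _.
  by apply: supp_inU; rewrite /fword_deg /= size_labels subrr.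
- apply: val_inj; rewrite -[LHS]/(quilt_val (op_d Quilt (QuiltMod qx0))) Quilt_dE /=.
  rewrite lin_lin -[RHS](lin0f _ y); apply: eq_lin => T _; rewrite linU /=.
  have -> : fword_d (FWord (labels_is_fword T)) = 0; last by rewrite tensE lin0.
  by rewrite -[LHS]fword_chainK fword_chain_d bdry_uniq ?tree_uniq ?lin0.
rewrite quilt_to_braceE /= lin_lin -[RHS]lin_id; apply: eq_lin => T _.
by rewrite linU /quilt_proj /= size_labels eqxx.
Qed.

Theorem theorem2p4 :
  dg_operad_morphism Quilt Brace quilt_to_brace /\
  quasi_isomorphism Quilt Brace quilt_to_brace.
Proof.
split; first exact: quilt_to_brace_morphism.
(* The differential of [Brace] is zero, so [e] says that x lies in the kernel of the projection. *)
move=> n k; split=> [x cx [y _ e]|y [hy _]]; first exact: quilt_exact cx e.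
have [x cx <-] := quilt_surjective hy; exists x => //.
by exists 0; rewrite ?subrr //= eqxx orbT.
Qed.
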